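(* Let $G=G_0$ be a finite simple graph of maximal dimension $d$ (i.e. its largest complete subgraph has $d+1$ vertices), and let $G_n$ denote its $n$-th Barycentric refinement. Then the limit $\lim_{n\to\infty} i(G_n)$ of the tree forest indices exists, and its value depends only on $d$ (not on the particular graph $G$). For $d=1$ the limit equals $2\log(\phi)$, where $\phi=(1+\sqrt5)/2$ is the golden ratio.
   Context: For a finite simple graph $G=(V,E)$, the Kirchhoff matrix is $K=D-A$, where $D$ is the diagonal matrix of vertex degrees and $A$ the adjacency matrix. The pseudo-determinant ${\rm Det}(K)$ is the product of the non-zero eigenvalues of $K$ (counted with multiplicity), with ${\rm Det}=1$ if there are none. The tree-forest ratio is $\tau(G)={\rm det}(1+K)/{\rm Det}(K)=\prod_{\lambda\neq 0}(1+1/\lambda)$ (product over non-zero eigenvalues of $K$), and the tree forest index is $i(G)=\log(\tau(G))/|V(G)|$. The Barycentric refinement $G_1$ of $G$ is the graph whose vertices are the complete subgraphs (nonempty cliques) of $G$, two being adjacent if one is properly contained in the other; $G_{n+1}$ is the Barycentric refinement of $G_n$. *)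

(* Defs.v *)
From HB Require Import structures.
From mathcomp Require Import all_boot all_order all_algebra.
From mathcomp Require Import all_classical all_reals all_analysis.
From mathcomp Require Import complex.
Set Implicit Arguments. Unset Strict Implicit. Unset Printing Implicit Defensive.
Import Order.TTheory GRing.Theory Num.Theory.
Local Open Scope ring_scope.

Record graph := Graph { vert : finType; adj : rel vert }.

Definition simple_graph (G : graph) : Prop :=
  symmetric (@adj G) /\ irreflexive (@adj G).

Definition is_clique (G : graph) (A : {set vert G}) : bool :=
  [forall x in A, forall y in A, (x != y) ==> adj x y].

Definition bary_vert (G : graph) : finType :=
  {A : {set vert G} | is_clique A && (A != finset.set0)}.

Definition bary_adj (G : graph) : rel (bary_vert G) :=
  fun A B => (val A \proper val B) || (val B \proper val A).

Definition bary (G : graph) : graph := @Graph (bary_vert G) (@bary_adj G).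

Fixpoint bary_iter (n : nat) (G : graph) : graph :=
  match n with 0 => G | n'.+1 => bary (bary_iter n' G) end.

Definition max_clique_size (G : graph) : nat :=
  \max_(A : {set vert G} | is_clique A) #|A|.
Definition gdim (G : graph) : nat := (max_clique_size G).-1.

Section Kirchhoff.
Variable R : realType.
Variable G : graph.
Local Notation n := #|vert G|.
Definition vtx (i : 'I_n) : vert G := enum_val i.
Definition degree (x : vert G) : nat := #|[set y | adj x y]|.

Definition kirchhoff : 'M[R[i]]_n :=
  \matrix_(i, j) (if i == j then (degree (vtx i))%:R
                  else - ((adj (vtx i) (vtx j) : nat)%:R)).

(* eigenvalues with multiplicity: the roots of the characteristic polynomial *)
Definition eigenvalues (M : 'M[R[i]]_n) : seq R[i] :=
  sval (closed_field_poly_normal (char_poly M)).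

Definition pdet (M : 'M[R[i]]_n) : R[i] :=
  \prod_(z <- eigenvalues M | z != 0) z.

Definition tree_forest_ratio : R[i] :=
  \det (1%:M + kirchhoff) / pdet kirchhoff.

(* tree forest index i(G) = log(tau(G))/|V(G)|  (tau(G) is real positive) *)
Definition tree_forest_index : R :=
  ln (complex.Re tree_forest_ratio) / n%:R.
End Kirchhoff.

(* Main.v *)
Require Import Defs.
From HB Require Import structures.
From mathcomp Require Import all_boot all_order all_algebra.
From mathcomp Require Import all_classical all_reals all_analysis.
From mathcomp Require Import complex.
From mathcomp Require Import ring lra spectral sesquilinear.
From mathcomp Require Import bigop fintype finset.
Import Order.TTheory GRing.Theory Num.Theory.
Import numFieldNormedType.Exports.
Set Implicit Arguments. Unset Strict Implicit. Unset Printing Implicit Defensive.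

(** Put [m = (d+1)!] and let [D n] be the [n]-th refinement of the [d]-simplex.  The
   [n]-th refinement of [G] is obtained by gluing one copy of [D n] for each of
   the [f] facets ([(d+1)]-cliques) of [G]; the cliques touching the glued
   boundary form an exponentially small part, because refining a [d]-simplex
   yields [m] simplices of which at most [d * d!] touch a proper face, and
   [d * d! < m].  Deleting an edge is a rank one change, which alters
   [ln det (1 + c K)] by at most [2 ln (1 + c)].  Hence [ln det (1 + K)] and
   [ln det (eps + K)] are additive over facets up to [O (rho^n ln (1/eps))]
   with [rho < m].

   The nonzero eigenvalues of [K] are at least [|V|^-3] (follow a path joining
   two vertices) and the multiplicity of [0] is bounded along the refinements,
   so for [eps] of size [|V|^-4] the quantity [ln det (1 + K) - ln det (eps + K)]
   approximates [ln tau] up to [O (n)].  Therefore [ln tau (G_n) - f * ln tau (D n)]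
   is [O (n rho^n)].  Taking for [G] the refined simplex, with [f = m], shows
   that [ln tau (D n) / m^n] converges, and likewise for the number of vertices.

   When [d = 1] the limit may be computed on the refinements of a 4-cycle.
   There eliminating the new vertices gives
   [det (t + K (G_1)) = det (t^2 + 4 t + K (G))], and [t |-> t^2 + 4 t] is
   [s |-> s^2 - 2] in the variable [s = t + 2], whose orbit starting at [3] is
   [phi^(2^(n+1)) + phi^-(2^(n+1))]. *)

(** * Flags of a finite set *)

(** Facets cannot be compared through the pseudo-determinant itself: deleting an edge may turn a
    tiny eigenvalue into [0], and then the product of the nonzero ones loses that factor altogether.
    [det (eps + K)] changes by a controlled factor, at a cost that grows only like [ln (1/eps)].
    This is why [eps] may be exponentially small in [n], and why a crude bound on the number of
    vertices suffices to choose it.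

    Refining a clique that touches the boundary yields, besides flags, many cliques with fewer
    vertices; one such clique may yield more than [m] new ones in all. Each clique [A] is therefore
    counted with the weight [W ^ #|A|], where [W] is so large that the shorter ones add only [1/2]
    to the rate. This gives [rho = d * d! + 1/2], which is less than [m = d * d! + d!].

    All comparisons start from [bary G], since the interior of a facet acquires a vertex, the
    barycenter, only with the first refinement. Dimension [0], where there are no edges, is treated
    apart. *)

Section Chains.
Variable T : finType.
Implicit Types (S B : {set T}) (F G : {set {set T}}).

Definition chain F : bool :=
  [forall A in F, forall B in F, (A \subset B) || (B \subset A)].

Lemma chainP F : reflect
  (forall A B, A \in F -> B \in F -> (A \subset B) || (B \subset A)) (chain F).
Proof.
apply: (iffP forall_inP) => H A; first by move=> B /H /forall_inP; apply.
by move=> AF; apply/forall_inP => B; apply: H.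
Qed.

Lemma chain_sub F G : F \subset G -> chain G -> chain F.
Proof. by move=> /subsetP sFG /chainP cG; apply/chainP=> A B /sFG ? /sFG ?; apply: cG. Qed.

(** A member of largest cardinality contains all the others, so it is the union. *)
Lemma cover_chain_in F : chain F -> F != set0 -> cover F \in F.
Proof.
move=> /chainP cF /set0Pn[A0 A0F].
have [A AF Amax] := arg_maxnP (fun A : {set T} => #|A|) A0F.
suff -> : cover F = A by [].
apply/eqP; rewrite eqEsubset (bigcup_sup A) // andbT.
apply/bigcupsP => B BF; have /orP[//|sAB] := cF B A BF AF.
by have /eqP -> : A == B by rewrite eqEcard sAB; apply: Amax.
Qed.

Lemma cover_sub F G : F \subset G -> cover F \subset cover G.
Proof.
move=> /subsetP sFG; apply/bigcupsP => A /sFG AG; exact: bigcup_sup AG.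
Qed.

(** Removing the top member leaves a chain whose union is strictly smaller, so each member costs at
    least one point. *)
Lemma card_chain_le F : chain F -> set0 \notin F -> #|F| <= #|cover F|.
Proof.
move: {2}#|F| (leqnn #|F|) => n; elim: n F => [|n IHn] F.
  by rewrite leqn0 => /eqP ->.
move=> leFn cF F0; have [->|Fn0] := eqVneq F set0; first by rewrite cards0.
have UF := cover_chain_in cF Fn0; set U := cover F in UF *.
rewrite (cardsD1 U F) UF add1n.
set F' := F :\ U; have sF' : F' \subset F by apply: subD1set.
have [->|F'n0] := eqVneq F' set0.
  by rewrite cards0 card_gt0; apply: contraNneq F0 => U0; rewrite -U0.
have cF' := chain_sub sF' cF.
have UF' := cover_chain_in cF' F'n0.
have leF' : #|F'| <= #|cover F'|.
  apply: IHn => //; first by move: leFn; rewrite (cardsD1 U F) UF.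
  by apply: contraNN F0 => /(subsetP sF').
apply: leq_ltn_trans leF' _; apply: proper_card; rewrite properEneq cover_sub //.
by rewrite andbT; move: UF'; rewrite !inE => /andP[].
Qed.

(** Maximality is encoded by the number of members: by [card_chain_le], a chain of nonempty subsets
    of [S] cannot have more than [#|S|] of them. *)
Definition flags S : {set {set {set T}}} :=
  [set F | [&& chain F, set0 \notin F, cover F \subset S & #|F| == #|S|]].

(** A flag has one set of each size, so the condition says that its singleton is a point of [B].
    This explains the count [#|B| * (#|S|.-1)!] below. *)
Definition flags_meeting S B : {set {set {set T}}} :=
  [set F in flags S | [exists A in F, A \subset B]].

Lemma flagsP S F : F \in flags S ->
  [/\ chain F, set0 \notin F, cover F = S & #|F| = #|S|].
Proof.
rewrite inE => /and4P[cF F0 sFS /eqP eF]; split=> //.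
by apply/eqP; rewrite eqEcard sFS -eF card_chain_le.
Qed.

Lemma flags_top S F : S != set0 -> F \in flags S -> S \in F.
Proof.
move=> S0 /flagsP[cF _ eS eF]; rewrite -{1}eS; apply: cover_chain_in => //.
by rewrite -card_gt0 eF card_gt0.
Qed.

(** Without [S], a chain of [#|S| - 1] nonempty sets is left. Its union has at least that many
    points, and it is not [S], because it is empty or a member different from [S]. *)
Lemma flags_pred S F : S != set0 -> F \in flags S ->
  exists2 x, x \in S & cover (F :\ S) = S :\ x.
Proof.
move=> S0 FS; have SF := flags_top S0 FS; have [cF F0 eS eF] := flagsP FS.
set G := F :\ S; have sG : G \subset F by apply: subD1set.
have cG := chain_sub sG cF.
have G0 : set0 \notin G by apply: contraNN F0 => /(subsetP sG).
have eG : #|F| = #|G|.+1 by rewrite (cardsD1 S) SF.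
have sGS : cover G \subset S by rewrite -eS cover_sub.
have leG := card_chain_le cG G0.
have pGS : cover G \proper S.
  have [G_0|Gn0] := eqVneq G set0; first by rewrite G_0 /cover big_set0 proper0.
  rewrite properEneq sGS andbT.
  by have := cover_chain_in cG Gn0; rewrite !inE => /andP[].
have [_ [x xS xG]] := properP pGS.
exists x => //; apply/eqP; rewrite eqEcard subsetD1 sGS xG /=.
by move: (cardsD1 x S); rewrite xS -eF eG add1n => -[<-].
Qed.

Lemma flags_add S x G : x \in S -> G \in flags (S :\ x) ->
  [/\ S |: G \in flags S, S \notin G & cover G = S :\ x].
Proof.
move=> xS /flagsP[cG G0 eG cardG].
have SG : S \notin G.
  apply/negP => SG; have sSG : S \subset cover G by apply: bigcup_sup SG.
  by have := subsetP sSG x xS; rewrite eG !inE eqxx.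
split=> //; rewrite inE; apply/and4P; split.
- apply/chainP => A B; rewrite !inE => /orP[/eqP->|AG] /orP[/eqP->|BG]; rewrite ?subxx //.
  + suff -> : B \subset S by rewrite orbT.
    apply: subset_trans (subD1set S x); rewrite -eG; exact: bigcup_sup BG.
  + suff -> : A \subset S by [].
    apply: subset_trans (subD1set S x); rewrite -eG; exact: bigcup_sup AG.
  + exact: (chainP _ cG).
- by rewrite !inE negb_or G0 andbT; apply: contraTneq xS => <-; rewrite inE.
- apply/bigcupsP => A; rewrite !inE => /orP[/eqP-> //|AG].
  apply: subset_trans (subD1set S x); rewrite -eG; exact: bigcup_sup AG.
- by rewrite cardsU1 SG cardG (cardsD1 x S) xS.
Qed.

(* Removing the top element [S] of a flag leaves a flag of [S :\ x] for a unique
   [x], which gives the recursion behind the induction. *)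
Lemma card_flags_meeting S B : B \subset S ->
  #|flags_meeting S B| = (#|B| * (#|S|.-1)`!)%N.
Proof.
move: {2}#|S| (erefl #|S|) => n; elim: n S B => [|n IHn] S B cS sBS.
  have S0 : S = set0 by apply/eqP; rewrite -cards_eq0 cS.
  have B0 : B = set0 by apply/eqP; rewrite -subset0 -S0.
  rewrite B0 cards0 mul0n; apply/eqP; rewrite cards_eq0 -subset0.
  apply/subsetP => F; rewrite inE => /andP[/flagsP[_ _ _ eF] /exists_inP[A AF _]].
  by move: eF; rewrite S0 cards0 => /eqP; rewrite cards_eq0 => /eqP F0; rewrite F0 inE in AF.
have S0 : S != set0 by rewrite -card_gt0 cS.
pose f x := S :\ x.
have injf : {in S &, injective f}.
  move=> x y xS yS /setP /(_ x); rewrite !inE eqxx xS /= andbT.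
  by move/esym/negbT; rewrite negbK => /eqP.
rewrite -sum1_card (partition_big (fun F : {set {set T}} => cover (F :\ S))
   (mem (f @: S))) /=; last first.
  move=> F; rewrite inE => /andP[/(flags_pred S0)[x xS ->] _].
  exact: imset_f.
rewrite big_imset //=.
pose N x := #|[set F in flags_meeting S B | cover (F :\ S) == S :\ x]|.
rewrite (eq_bigr N); last first.
  by move=> x xS; rewrite /N -sum1_card; apply: eq_bigl => F; rewrite !inE.
(* A singleton is done by hand: below its top the flag is empty, so a member inside [B] cannot be
   sought there. *)
have [n0|n_gt0] := posnP n.
  move: cS; rewrite n0 => /eqP /cards1P[x Sx].
  rewrite Sx big_set1 cards1 fact0 muln1.
  have EF F : F \in flags S -> F = [set S].
    move=> FS; apply/esym/eqP; rewrite eqEcard sub1set flags_top // cards1.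
    by have [_ _ _ ->] := flagsP FS; rewrite Sx cards1.
  move: sBS; rewrite Sx subset1 => /orP[]/eqP EB; rewrite EB ?cards1 ?cards0.
    apply/eqP/cards1P; exists [set S]; apply/setP => F; rewrite inE in_set1.
    apply/idP/idP => [/andP[]|/eqP->].
      by rewrite inE => /andP[/EF -> _].
    have -> : cover ([set S] :\ S) = set0 by rewrite setDv /cover big_set0.
    rewrite Sx setDv eqxx andbT inE -Sx; apply/andP; split.
      rewrite inE; apply/and4P; split.
      - by apply/chainP => A A'; rewrite !inE => /eqP-> /eqP->; rewrite subxx.
      - by rewrite inE eq_sym.
      - by rewrite /cover big_set1.
      - by rewrite cards1 Sx cards1.
    by apply/exists_inP; exists S; [rewrite in_set1 | rewrite EB Sx].
  apply/eqP; rewrite cards_eq0 -subset0; apply/subsetP => F; rewrite inE => /andP[].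
  rewrite inE => /andP[/flagsP[_ F0 _ _] /exists_inP[A AF]].
  by rewrite EB subset0 => /eqP A0; move: F0; rewrite -A0 AF.
have NE x : x \in S -> N x = (#|B :\ x| * (n.-1)`!)%N.
  move=> xS; have cSx : #|S :\ x| = n by move: cS; rewrite (cardsD1 x) xS => -[].
  rewrite -[n.-1]/(n.-1) -{1}cSx -IHn ?setSD //.
  rewrite -(@card_in_imset _ _ (fun G => S |: G)); last first.
    move=> G G' GS G'S; rewrite inE in GS; rewrite inE in G'S.
    case/andP: GS => /(flags_add xS)[_ SG _] _.
    case/andP: G'S => /(flags_add xS)[_ SG' _] _.
    by move=> /(congr1 (fun H => H :\ S)); rewrite !setU1K.
  rewrite /N; congr #|pred_of_set _|; apply/setP => F; apply/idP/imsetP.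
    rewrite inE => /andP[]; rewrite inE => /andP[FS meet] /eqP eFx.
    have SF := flags_top S0 FS; have [cF F0 eS eF] := flagsP FS.
    exists (F :\ S); last by rewrite setD1K.
    rewrite inE; apply/andP; split.
      rewrite inE (chain_sub (subD1set F S)) // eFx subxx /= cSx.
      rewrite !inE (negbTE F0) andbF /=.
      by move: eF; rewrite (cardsD1 S F) SF cS add1n => -[->].
    have /exists_inP[A AF sAB] := meet.
    have sx A' : A' \in F :\ S -> A' \subset S :\ x.
      by move=> A'F; rewrite -eFx; apply: bigcup_sup A'F.
    (* If the member inside [B] is [S] itself, then [B] is all of [S] and any remaining member lies
       in [B :\ x]. *)
    have [AS|AS] := eqVneq A S.
      have /set0Pn[A' A'F] : F :\ S != set0.
        by rewrite -card_gt0; move: eF; rewrite (cardsD1 S F) SF cS add1n => -[->].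
      apply/exists_inP; exists A' => //.
      by rewrite (subset_trans (sx _ A'F)) // setSD // -AS.
    have AF' : A \in F :\ S by rewrite !inE AS.
    apply/exists_inP; exists A => //.
    have := sx _ AF'; rewrite !subsetD1 => /andP[_ ->].
    by rewrite sAB.
  case=> G /setIdP[GS /exists_inP[A AG sAB]] ->.
  have [FS SG eG] := flags_add xS GS.
  rewrite inE; apply/andP; split; last by rewrite setU1K // eG.
  rewrite inE FS /=; apply/exists_inP; exists A; first by rewrite !inE AG orbT.
  exact: subset_trans sAB (subD1set _ _).
rewrite (eq_bigr _ NE) cS /= -big_distrl /=.
(* [#|B :\ x|] falls short of [#|B|] by one exactly for [x] in [B], so the sum is
   [#|B| * n.+1 - #|B|]. *)
have -> : (\sum_(x in S) #|B :\ x| = #|B| * n)%N.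
  apply/eqP; rewrite -(eqn_add2r #|B|) -mulnSr -cS.
  have EB : (#|B| = \sum_(x in S) (x \in B))%N.
    rewrite -sum1_card big_mkcond [in RHS]big_mkcond /=; apply: eq_bigr => x _.
    by case: ifP => [/(subsetP sBS) ->|_] //; case: ifP.
  rewrite {1}EB -big_split /= mulnC -sum_nat_const; apply/eqP/eq_bigr => x _.
  by rewrite (cardsD1 x B) addnC.
by case: n n_gt0 {IHn cS NE} => // n _; rewrite factS mulnA.
Qed.

End Chains.

(** * Cliques of the barycentric refinement *)

Section Cliques.
Variable G : graph.
Implicit Types A : {set vert G}.

Lemma is_cliqueP A :
  reflect {in A &, forall x y, x != y -> adj x y} (is_clique A).
Proof.
apply: (iffP forall_inP) => H x.
  by move=> y xA yA; have /forall_inP/(_ y yA)/implyP := H x xA.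
by move=> xA; apply/forall_inP => y yA; apply/implyP; apply: H.
Qed.

Lemma is_clique_sub (A B : {set vert G}) : A \subset B -> is_clique B -> is_clique A.
Proof.
by move=> /subsetP sAB /is_cliqueP cB; apply/is_cliqueP => x y /sAB ? /sAB ?; apply: cB.
Qed.

Lemma is_clique0 : is_clique (finset.set0 : {set vert G}).
Proof. by apply/is_cliqueP => x y; rewrite inE. Qed.

End Cliques.
Arguments is_cliqueP {G A}.

Section BarycentricCliques.
Variable G : graph.
Implicit Types (A : {set vert G}) (F : {set vert (bary G)}).

Lemma bary_simple : simple_graph (bary G).
Proof.
split=> [A B|A]; rewrite /adj /= /bary_adj; first by rewrite orbC.
by rewrite properxx.
Qed.

Lemma bary_vert_clique (s : vert (bary G)) : is_clique (val s).
Proof. by case/andP: (valP s). Qed.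

Lemma bary_vert_neq0 (s : vert (bary G)) : val s != finset.set0.
Proof. by case/andP: (valP s). Qed.

Definition vals F : {set {set vert G}} := [set val s | s : vert (bary G) in F].
(** For a clique [F] this is the carrier of the simplex: the smallest simplex of [G] whose
    refinement contains it. *)
Definition top F : {set vert G} := cover (vals F).

Lemma vals_inj : injective vals.
Proof. exact/imset_inj/val_inj. Qed.

Lemma card_vals F : #|vals F| = #|F|.
Proof. exact/card_imset/val_inj. Qed.

Lemma set0_notin_vals F : finset.set0 \notin vals F.
Proof. by apply/imsetP => -[s _ /esym/eqP]; apply/negP/bary_vert_neq0. Qed.

Lemma is_clique_chain F : is_clique F = chain (vals F).
Proof.
apply/idP/idP => [/is_cliqueP cF|/chainP cF].
  apply/chainP => _ _ /imsetP[s sF ->] /imsetP[t tF ->].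
  have [->|/cF] := eqVneq s t; first by rewrite subxx.
  by move=> /(_ sF tF); rewrite /adj /= /bary_adj => /orP[]/proper_sub->; rewrite ?orbT.
apply/is_cliqueP => s t sF tF st; have := cF _ _ (imset_f val sF) (imset_f val tF).
have st' : val s != val t by [].
rewrite /adj /= /bary_adj !properEneq st' [val t == val s]eq_sym st' /=.
exact: id.
Qed.

Lemma top_in_vals F : is_clique F -> F != finset.set0 -> top F \in vals F.
Proof.
rewrite is_clique_chain => cF F0; apply: cover_chain_in => //.
by rewrite -card_gt0 card_vals card_gt0.
Qed.

Lemma top_clique F : is_clique F -> is_clique (top F).
Proof.
move=> cF; have [->|F0] := eqVneq F finset.set0.
  by rewrite /top /vals imset0 /cover big_set0 is_clique0.
by have /imsetP[s _ ->] := top_in_vals cF F0; apply: bary_vert_clique.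
Qed.

Lemma card_top_ge F : is_clique F -> #|F| <= #|top F|.
Proof.
rewrite is_clique_chain -card_vals => cF.
exact/card_chain_le/set0_notin_vals.
Qed.

Lemma vals_flags F : is_clique F -> #|F| = #|top F| -> vals F \in flags (top F).
Proof.
rewrite is_clique_chain inE => cF eF.
by rewrite cF set0_notin_vals subxx card_vals eF eqxx.
Qed.

Lemma vals_powerset F : vals F \in powerset (powerset (top F)).
Proof. by rewrite inE; apply/subsetP => A AF; rewrite inE; apply: bigcup_sup AF. Qed.

End BarycentricCliques.

Definition clique_le k (G : graph) : Prop :=
  forall A : {set vert G}, is_clique A -> #|A| <= k.

Lemma clique_le_bary k G : clique_le k G -> clique_le k (bary G).
Proof.
move=> kG F cF; exact: leq_trans (card_top_ge cF) (kG _ (top_clique cF)).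
Qed.

Definition num_cliques (G : graph) k := #|[set A : {set vert G} | is_clique A & #|A| == k]|.

(** The top of a clique of size [k.+1] has at least as many vertices, and by hypothesis no more.
    Such cliques are thus the flags of the cliques of size [k.+1] of [G]. *)
Lemma num_cliques_bary k G : clique_le k.+1 G ->
  num_cliques (bary G) k.+1 = ((k.+1)`! * num_cliques G k.+1)%N.
Proof.
move=> kG; rewrite /num_cliques -sum1_card.
rewrite (partition_big (@top G)
  (mem [set A : {set vert G} | is_clique A & #|A| == k.+1])) /=; last first.
  move=> F; rewrite !inE => /andP[cF /eqP eF]; rewrite top_clique //= eqn_leq.
  by rewrite kG ?top_clique // -{1}eF card_top_ge.
rewrite (eq_bigr (fun=> (k.+1)`!)) ?sum_nat_const 1?mulnC // => A.
rewrite inE => /andP[cA /eqP eA].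
(* With [B] equal to the nonempty set [A], every flag of [A] is counted. *)
transitivity #|flags_meeting A A|; last by rewrite card_flags_meeting // eA.
rewrite sum1dep_card -(card_imset _ (@vals_inj G)).
congr #|pred_of_set _|; apply/setP => X; apply/imsetP/idP.
  case=> F; rewrite inE => /andP[]; rewrite inE => /andP[cF /eqP eF] /eqP eA' ->.
  rewrite inE -{1}eA' vals_flags ?eA' ?eA //=.
  apply/exists_inP; exists (top F); last by rewrite eA'.
  by apply: top_in_vals => //; rewrite -card_gt0 eF.
rewrite inE => /andP[/flagsP[cX X0 covX cardX] _].
pose F := [set s : vert (bary G) | val s \in X].
have EX : vals F = X.
  apply/setP => B; apply/imsetP/idP => [[s]|BX]; first by rewrite inE => ? ->.
  have cB : is_clique B && (B != finset.set0).
    rewrite (is_clique_sub _ cA) /=; last by rewrite -covX; apply: bigcup_sup BX.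
    by apply: contraNneq X0 => <-.
  by exists (Sub B cB); rewrite ?inE SubK.
exists F => //; rewrite inE /top EX covX eqxx andbT inE is_clique_chain EX cX.
by rewrite -card_vals EX cardX eA eqxx.
Qed.

Lemma num_cliques_le_card_bary k G : num_cliques G k.+1 <= #|vert (bary G)|.
Proof.
rewrite card_sig; apply: subset_leq_card; apply/subsetP => A; rewrite !inE.
by case/andP=> -> /eqP eA; rewrite -card_gt0 eA.
Qed.

(** A clique with top [A] is a set of subsets of [A]. The bound may be this crude because it only
    serves to choose [eps], and so enters the errors through its logarithm. *)
Lemma card_bary_bary d G : clique_le d G ->
  #|vert (bary (bary G))| <= 2 ^ 2 ^ d * #|vert (bary G)|.
Proof.
move=> dG; rewrite !card_sig -!sum1_card.
rewrite (partition_big (@top G)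
  (fun A : {set vert G} => is_clique A && (A != finset.set0))) /=; last first.
  move=> F; rewrite inE => /andP[cF F0]; rewrite top_clique //=.
  by rewrite -card_gt0 (leq_trans _ (card_top_ge cF)) ?card_gt0.
rewrite big_distrr /=; apply: leq_sum => A /andP[cA _]; rewrite muln1 sum1dep_card.
apply: (@leq_trans #|powerset (powerset A)|); last first.
  by rewrite !card_powerset !leq_pexp2l ?dG // expn_gt0.
rewrite -(card_imset _ (@vals_inj G)); apply: subset_leq_card.
apply/subsetP => X /imsetP[F]; rewrite inE => /andP[_ /eqP <-] ->.
exact: vals_powerset.
Qed.

(** * Simplices touching the boundary of the facets *)

Section Boundary.
Implicit Types G : graph.

(* [int] marks the interior vertices of a graph; a simplex of the refinement is
   interior as soon as it has an interior vertex. *)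
Definition up G (int : pred (vert G)) : pred (vert (bary G)) :=
  fun s => [exists x in val s, int x].

Definition bad_clique G (int : pred (vert G)) (A : {set vert G}) : bool :=
  is_clique A && [exists x in A, ~~ int x].

Definition bad_weight W G (int : pred (vert G)) : nat :=
  \sum_(A | bad_clique int A) W ^ #|A|.

(** A clique of full size then has at most [d] vertices on the boundary, hence at most [d * d!]
    flags starting there instead of all [(d+1)!]. *)
Definition meets_facets d G (int : pred (vert G)) : Prop :=
  forall A, is_clique A -> #|A| = d.+1 -> [exists x in A, int x].

Lemma meets_facets_bary d G (int : pred (vert G)) :
  clique_le d.+1 G -> meets_facets d int -> meets_facets d (up int).
Proof.
move=> dG mG F cF eF.
have F0 : F != finset.set0 by rewrite -card_gt0 eF.
have et : #|top F| = d.+1.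
  by apply/eqP; rewrite eqn_leq dG ?top_clique // -eF card_top_ge.
have /imsetP[s sF es] := top_in_vals cF F0.
by apply/exists_inP; exists s => //; rewrite /up -es; apply: mG => //; apply: top_clique.
Qed.

(* A bad clique [F] of the refinement is a chain whose top is a bad clique [A] of
   [G].  If [#|F| = #|A|] then [F] is a flag of [A] with an element on the
   boundary, and there are at most [d * d!] of these; otherwise [F] is one of at
   most [M] chains and has weight at most [W ^ #|A| / W], where [M / W = 1 / 2]. *)
Lemma bad_weight_bary d G (int : pred (vert G)) (M := 2 ^ 2 ^ d.+1) :
  0 < d -> clique_le d.+1 G -> meets_facets d int ->
  2 * bad_weight (2 * M) (up int) <= (2 * (d * d`!) + 1) * bad_weight (2 * M) int.
Proof.
move=> d0 dG mG; rewrite /bad_weight; set W := 2 * M.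
have W0 : 0 < W by rewrite muln_gt0 expn_gt0.
rewrite (partition_big (@top G) (bad_clique int)) /=; last first.
  move=> F /andP[cF /exists_inP[s sF nis]].
  rewrite /bad_clique top_clique //=.
  have /set0Pn[x xs] := bary_vert_neq0 s.
  apply/exists_inP; exists x.
    by apply/bigcupP; exists (val s) => //; apply: imset_f.
  by move: nis; apply: contraNN => ix; apply/exists_inP; exists x.
rewrite big_distrr [X in _ <= X]big_distrr /=; apply: leq_sum => A /andP[cA /exists_inP[x0 x0A nix0]].
set B := [set x in A | ~~ int x].
have sBA : B \subset A by apply/subsetP => x; rewrite inE => /andP[].
have A0 : 0 < #|A| by apply/card_gt0P; exists x0.
pose P F := bad_clique (up int) F && (top F == A).
have le1 F : P F -> W ^ #|F| <= (vals F \in flags_meeting A B) * W ^ #|A| + W ^ #|A|.-1.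
  move=> /andP[/andP[cF /exists_inP[s sF nis]] /eqP eA].
  have := card_top_ge cF; rewrite eA leq_eqVlt => /orP[/eqP eF|ltF].
    suff -> : vals F \in flags_meeting A B by rewrite mul1n eF leq_addr.
    rewrite inE; apply/andP; split.
      by rewrite -eA vals_flags // eA.
    apply/exists_inP; exists (val s); first exact: imset_f.
    apply/subsetP => x xs; rewrite inE -eA; apply/andP; split.
      by apply/bigcupP; exists (val s) => //; apply: imset_f.
    by apply: contraNN nis => ix; apply/exists_inP; exists x.
  apply: leq_trans (leq_addl _ _); rewrite leq_pexp2l //.
  by rewrite -ltnS prednK.
apply: (@leq_trans (2 * (#|flags_meeting A B| * W ^ #|A| + M * W ^ #|A|.-1))).
  rewrite leq_mul2l /=; apply: (@leq_trans (\sum_(F | P F)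
    ((vals F \in flags_meeting A B) * W ^ #|A| + W ^ #|A|.-1))); first exact: leq_sum.
  rewrite big_split /= -big_distrl /= sum_nat_const.
  apply: leq_add; rewrite leq_mul2r; apply/orP; right.
    rewrite (eq_bigr (fun F => if vals F \in flags_meeting A B then 1 else 0)).
      rewrite -big_mkcondr /= sum1dep_card -(card_imset _ (@vals_inj G)).
      apply: subset_leq_card; apply/subsetP => X /imsetP[F].
      by rewrite inE => /andP[_ FB] ->.
    by move=> F _; case: (_ \in _).
  rewrite -(card_imset _ (@vals_inj G)).
  apply: (@leq_trans #|powerset (powerset A)|).
    apply: subset_leq_card; apply/subsetP => X /imsetP[F PF ->].
    have /andP[_ /eqP <-] : P F := PF; exact: vals_powerset.
  by rewrite !card_powerset !leq_pexp2l ?dG.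
rewrite mulnDr mulnDl; apply: leq_add.
  rewrite mulnA leq_mul2r; apply/orP; right; rewrite leq_mul2l /=.
  rewrite card_flags_meeting //.
  have := dG _ cA; rewrite leq_eqVlt => /orP[/eqP eA|].
    rewrite eA /= leq_mul2r; apply/orP; right; rewrite -ltnS -eA.
    apply: proper_card; rewrite properEneq sBA andbT.
    have /exists_inP[x xA ix] := mG _ cA eA.
    by apply: contraTneq xA => <-; rewrite inE ix andbF.
  (* A smaller [A] may lie entirely on the boundary, but then both [#|B|] and the factorial are
     small enough. *)
  rewrite ltnS => leA; apply: leq_mul; first exact: leq_trans (subset_leq_card sBA) leA.
  by apply: leq_fact; apply: leq_trans (leq_pred _) leA.
by rewrite mul1n mulnA -expnS prednK.
Qed.

End Boundary.

Lemma card_bad_cliques_le W G (int : pred (vert G)) : 0 < W ->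
  #|[set A | bad_clique int A]| <= bad_weight W int.
Proof.
move=> W0; rewrite -sum1dep_card; apply: leq_sum => A _.
by rewrite expn_gt0 W0.
Qed.

Lemma bad_vertices_le W G (int : pred (vert G)) : 0 < W ->
  #|[set x | ~~ int x]| <= bad_weight W int.
Proof.
move=> W0; apply: leq_trans (card_bad_cliques_le int W0).
rewrite -(card_imset _ (@finset.set1_inj _)); apply: subset_leq_card.
apply/subsetP => X /imsetP[x nix ->]; rewrite inE in nix; rewrite inE.
apply/andP; split; last by apply/exists_inP; exists x; rewrite ?inE.
by apply/is_cliqueP => y z; rewrite !inE => /eqP-> /eqP->; rewrite eqxx.
Qed.

Definition bad_edges G (int : pred (vert G)) : {set vert G * vert G} :=
  [set p | adj p.1 p.2 & ~~ (int p.1 && int p.2)].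

(** The two ends of a bad edge form a bad clique, and a clique contains at most [d ^ 2] ordered
    pairs. *)
Lemma bad_edges_le W d G (int : pred (vert G)) : 0 < W ->
  simple_graph G -> clique_le d G ->
  #|bad_edges int| <= d ^ 2 * bad_weight W int.
Proof.
move=> W0 [symG irrG] dG; apply: leq_trans (leq_mul (leqnn _) (card_bad_cliques_le int W0)).
rewrite -sum1_card -sum1dep_card.
rewrite (partition_big (fun p : vert G * vert G => [set p.1; p.2])
  (bad_clique int)) /=; last first.
  move=> [x y]; rewrite inE /= => /andP[xy nint]; apply/andP; split.
    apply/is_cliqueP => u v; rewrite !inE.
    by move=> /orP[]/eqP-> /orP[]/eqP-> //; rewrite ?eqxx // symG.
  apply/exists_inP; move: nint; rewrite negb_and => /orP[nx|ny].
    by exists x; rewrite ?inE ?eqxx.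
  by exists y; rewrite ?inE ?eqxx ?orbT.
rewrite big_distrr /=; apply: leq_sum => A /andP[cA _]; rewrite muln1 sum1dep_card.
apply: (@leq_trans #|setX A A|).
  apply: subset_leq_card; apply/subsetP => -[x y]; rewrite !inE /= => /andP[_ /eqP<-].
  by rewrite !inE !eqxx orbT.
by rewrite cardsX -mulnn leq_mul ?dG.
Qed.

Fixpoint up_iter n G (int : pred (vert G)) : pred (vert (bary_iter n G)) :=
  match n return pred (vert (bary_iter n G)) with
  | 0 => int
  | n'.+1 => up (@up_iter n' G int)
  end.
Arguments up_iter n {G} int _.

Lemma clique_le_bary_iter n k G : clique_le k G -> clique_le k (bary_iter n G).
Proof. by move=> kG; elim: n => //= n IHn; apply: clique_le_bary. Qed.

Lemma bary_iter_bary n G : bary_iter n (bary G) = bary_iter n.+1 G.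
Proof. by elim: n => //= n ->. Qed.

Lemma meets_facets_iter n d G (int : pred (vert G)) :
  clique_le d.+1 G -> meets_facets d int -> meets_facets d (up_iter n int).
Proof.
move=> dG mG; elim: n => //= n IHn; apply: meets_facets_bary => //.
exact: clique_le_bary_iter.
Qed.

(** The rate is [d * d! + 1/2]; the powers of [2] keep the inequality in the natural numbers. *)
Lemma bad_weight_iter n d G (int : pred (vert G)) (W := 2 * 2 ^ 2 ^ d.+1) :
  0 < d -> clique_le d.+1 G -> meets_facets d int ->
  2 ^ n * bad_weight W (up_iter n int) <= (2 * (d * d`!) + 1) ^ n * bad_weight W int.
Proof.
move=> d0 dG mG; elim: n => [|n IHn]; first by rewrite !expn0.
have := bad_weight_bary d0 (@clique_le_bary_iter n _ _ dG) (@meets_facets_iter n _ _ _ dG mG).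
move=> /(leq_mul (leqnn (2 ^ n))) H.
rewrite !expnS [2 * 2 ^ n]mulnC -[2 ^ n * 2 * _]mulnA.
by apply: leq_trans H _; rewrite mulnCA -mulnA leq_mul2l IHn orbT.
Qed.

Lemma card_bary_iter n d G : clique_le d G ->
  #|vert (bary_iter n (bary G))| <= (2 ^ 2 ^ d) ^ n * #|vert (bary G)|.
Proof.
move=> dG; elim: n => [|n IHn]; first by rewrite expn0 mul1n.
rewrite !bary_iter_bary /= in IHn *.
apply: leq_trans (card_bary_bary (@clique_le_bary_iter n _ _ dG)) _.
by rewrite expnS -mulnA leq_mul2l IHn orbT.
Qed.

Lemma num_cliques_iter n k G : clique_le k.+1 G ->
  num_cliques (bary_iter n G) k.+1 = ((k.+1)`! ^ n * num_cliques G k.+1)%N.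
Proof.
move=> kG; elim: n => [|n IHn]; first by rewrite mul1n.
by rewrite num_cliques_bary ?IHn ?expnS ?mulnA //; apply: clique_le_bary_iter.
Qed.

(** * Copies of the refined simplex inside the refined graph *)

Section FacetEmbeddings.

(* [phi] identifies [D] with a full subgraph of [G] containing the closed
   neighbourhood of [intG], in such a way that [intG] corresponds to [intD]. *)
Definition facet_embedding (G D : graph) (intG : pred (vert G)) (intD : pred (vert D))
    (phi : vert D -> vert G) : Prop :=
  [/\ injective phi,
      (forall x y, adj (phi x) (phi y) = adj x y),
      (forall x y, intG x -> (x == y) || adj x y -> exists z, y = phi z) &
      (forall z, intG (phi z) = intD z)].

(** This makes the Laplacians of the interiors of distinct facets annihilate each other, so that
    determinants multiply. *)
Definition separated (I : finType) (G : graph) (intG : I -> pred (vert G)) : Prop :=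
  forall A B x y, intG A x -> intG B y -> (x == y) || adj x y -> A = B.

Lemma bary_map_exists (G D : graph) (phi : vert D -> vert G) :
  injective phi -> (forall x y, adj (phi x) (phi y) = adj x y) ->
  exists f : vert (bary D) -> vert (bary G), forall s, val (f s) = phi @: val s.
Proof.
move=> injphi adjphi.
have H (s : vert (bary D)) : is_clique (phi @: val s) && (phi @: val s != finset.set0).
  apply/andP; split; last by rewrite -card_gt0 card_imset // card_gt0 bary_vert_neq0.
  apply/is_cliqueP => _ _ /imsetP[x xs ->] /imsetP[y ys ->] nxy.
  rewrite adjphi; apply: (is_cliqueP (bary_vert_clique s)) => //.
  by apply: contraNneq nxy => ->.
by exists (fun s : vert (bary D) => Sub (phi @: val s) (H s) : vert (bary G)) => s; rewrite SubK.
Qed.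

Lemma imset_subset_inj (S T : finType) (f : S -> T) (A B : {set S}) :
  injective f -> (f @: A \subset f @: B) = (A \subset B).
Proof.
move=> injf; apply/idP/idP => [/subsetP sAB|]; last exact: imsetS.
by apply/subsetP => x xA; rewrite -(mem_imset _ _ injf) sAB ?imset_f.
Qed.

Lemma bary_map_embedding (G D : graph) (phi : vert D -> vert G)
    (f : vert (bary D) -> vert (bary G)) :
  injective phi -> (forall s, val (f s) = phi @: val s) ->
  injective f /\ (forall s t, adj (f s) (f t) = adj s t).
Proof.
move=> injphi vf; split=> [s t fst|s t].
  by apply/val_inj/(imset_inj injphi); rewrite -!vf fst.
by rewrite /adj /= /bary_adj !vf !properE !(imset_subset_inj _ _ injphi).
Qed.

Lemma bary_refl_adj_sub (G : graph) (s t : vert (bary G)) :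
  (s == t) || adj s t -> (val s \subset val t) || (val t \subset val s).
Proof.
move=> /orP[/eqP->|]; first by rewrite subxx.
by rewrite /adj /= /bary_adj => /orP[]/proper_sub->; rewrite ?orbT.
Qed.

(** A simplex [t] equal or adjacent to a simplex with an interior vertex [x] is comparable with it,
    so each vertex of [t] equals [x] or is adjacent to [x]. All of [t] therefore lies in the image
    of [phi] and comes from a simplex of [D]. *)
Lemma facet_embedding_bary (G D : graph) (intG : pred (vert G)) (intD : pred (vert D)) :
  (exists phi, facet_embedding intG intD phi) ->
  exists f, facet_embedding (up intG) (up intD) f.
Proof.
move=> [phi [injphi adjphi imphi intphi]].
have [f vf] := bary_map_exists injphi adjphi.
have [injf adjf] := bary_map_embedding injphi vf.
exists f; split=> //.
  move=> s t /exists_inP[x xs ix] st.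
  have xt y : y \in val t -> (x == y) || adj x y.
    move=> yt; have [//|nxy] := eqVneq x y.
    have /orP[sst|sts] := bary_refl_adj_sub st.
      by apply: (is_cliqueP (bary_vert_clique t)) => //; apply: subsetP sst _ _.
    by apply: (is_cliqueP (bary_vert_clique s)) => //; apply: subsetP sts _ _.
  pose B := phi @^-1: val t.
  have EB : phi @: B = val t.
    apply/setP => y; apply/imsetP/idP => [[z]|yt]; first by rewrite inE => ? ->.
    by have [z Ez] := imphi _ _ ix (xt y yt); exists z; rewrite ?inE -?Ez.
  have HB : is_clique B && (B != finset.set0).
    apply/andP; split.
      apply/is_cliqueP => u v; rewrite !inE => ut vt uv.
      rewrite -adjphi; apply: (is_cliqueP (bary_vert_clique t)) => //.
      by rewrite (inj_eq injphi).
    by rewrite -card_gt0 -(card_imset _ injphi) EB card_gt0 bary_vert_neq0.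
  by exists (Sub B HB); apply/val_inj; rewrite vf SubK EB.
move=> s; rewrite /up vf; apply/exists_inP/exists_inP.
  by case=> _ /imsetP[z zs ->]; rewrite intphi => iz; exists z.
by case=> z zs iz; exists (phi z); rewrite ?intphi // imset_f.
Qed.

Lemma separated_bary (I : finType) (G : graph) (intG : I -> pred (vert G)) :
  separated intG -> separated (fun A => up (intG A)).
Proof.
move=> sep A B s t /exists_inP[x xs ix] /exists_inP[y yt iy] st.
apply: (sep A B x y) => //; have [//|nxy] := eqVneq x y.
have /orP[sst|sts] := bary_refl_adj_sub st.
  by apply: (is_cliqueP (bary_vert_clique t)) => //; apply: subsetP sst _ _.
by apply: (is_cliqueP (bary_vert_clique s)) => //; apply: subsetP sts _ _.
Qed.

Lemma facet_embedding_iter n (G D : graph) (intG : pred (vert G)) (intD : pred (vert D)) :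
  (exists phi, facet_embedding intG intD phi) ->
  exists f, facet_embedding (up_iter n intG) (up_iter n intD) f.
Proof. by move=> H; elim: n => //= n; apply: facet_embedding_bary. Qed.

Lemma separated_iter n (I : finType) (G : graph) (intG : I -> pred (vert G)) :
  separated intG -> separated (fun A => up_iter n (intG A)).
Proof. by move=> sep; elim: n => //= n; apply: separated_bary. Qed.

Lemma up_iter_exists n (I : finType) (G : graph) (intG : I -> pred (vert G)) x :
  up_iter n (fun x => [exists A, intG A x]) x = [exists A, up_iter n (intG A) x].
Proof.
elim: n x => //= n IHn s; apply/exists_inP/existsP.
  by case=> x xs; rewrite IHn => /existsP[A iA]; exists A; apply/exists_inP; exists x.
by case=> A /exists_inP[x xs iA]; exists x; rewrite // IHn; apply/existsP; exists A.
Qed.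

End FacetEmbeddings.

Definition complete d : graph := @Graph 'I_d.+1 (fun x y => x != y).

Lemma complete_simple d : simple_graph (complete d).
Proof. by split=> [x y|x]; rewrite /adj /= ?eqxx // eq_sym. Qed.

Lemma complete_clique_le d : clique_le d.+1 (complete d).
Proof. by move=> A _; rewrite -[d.+1]card_ord; apply: max_card. Qed.

Lemma complete_clique d (A : {set vert (complete d)}) : is_clique A.
Proof. exact/is_cliqueP. Qed.

Lemma complete_num_cliques d : num_cliques (complete d) d.+1 = 1.
Proof.
apply/eqP/cards1P; exists [set: vert (complete d)]; apply/setP => A.
rewrite !inE complete_clique /= eqEcard subsetT cardsT card_ord /=.
by rewrite eqn_leq (complete_clique_le (complete_clique A)).
Qed.

Section FacetStart.
Variables (d : nat) (G : graph).

Definition facet : finType := {A : {set vert G} | is_clique A && (#|A| == d.+1)}.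
(** After one refinement the only interior vertex of a facet is its barycenter, the vertex [A]
    itself. *)
Definition facet_int (A : facet) : pred (vert (bary G)) := fun s => val s == val A.
Definition simplex_int : pred (vert (bary (complete d))) :=
  fun s => val s == [set: vert (complete d)].

Lemma card_facet : #|{: facet}| = num_cliques G d.+1.
Proof. by rewrite card_sig /num_cliques cardsE. Qed.

Lemma facet_separated : separated facet_int.
Proof.
move=> A B s t /eqP sA /eqP tB st; apply/val_inj/eqP.
have /andP[_ /eqP cA] := valP A; have /andP[_ /eqP cB] := valP B.
have := bary_refl_adj_sub st; rewrite sA tB => /orP[]sAB.
  by rewrite eqEcard sAB cA cB /=.
by rewrite eq_sym eqEcard sAB cA cB /=.
Qed.

(** No clique is larger than a facet, so the neighbours of its barycenter are its proper faces, and
    these are images of faces of the standard simplex. *)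
Lemma facet_start (A : facet) : simple_graph G -> clique_le d.+1 G -> 
  exists phi, facet_embedding (facet_int A) simplex_int phi.
Proof.
move=> [_ irrG] dG; have /andP[cA /eqP eA] := valP A.
pose psi (i : vert (complete d)) : vert G := enum_val (cast_ord (esym eA) i).
have psiA i : psi i \in val A by apply: enum_valP.
have injpsi : injective psi by move=> i j /enum_val_inj/cast_ord_inj.
have impsi x : x \in val A -> exists i, x = psi i.
  move=> xA; exists (cast_ord eA (enum_rank_in xA x)).
  by rewrite /psi cast_ordK enum_rankK_in.
have adjpsi i j : adj (psi i) (psi j) = adj i j.
  rewrite /(@adj (complete d)) /=; have [->|nij] := eqVneq i j.
    by rewrite irrG.
  by apply: (is_cliqueP cA) => //; rewrite (inj_eq injpsi).
have [f vf] := bary_map_exists injpsi adjpsi.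
have [injf adjf] := bary_map_embedding injpsi vf.
exists f; split=> //.
  move=> s t /eqP sA st.
  have sub : val t \subset val A.
    have := bary_refl_adj_sub st; rewrite sA => /orP[sAt|//].
    suff -> : val t = val A by [].
    by apply/esym/eqP; rewrite eqEcard sAt eA dG // bary_vert_clique.
  pose B := psi @^-1: val t.
  have EB : psi @: B = val t.
    apply/setP => y; apply/imsetP/idP => [[z]|yt]; first by rewrite inE => ? ->.
    by have [z Ez] := impsi _ (subsetP sub _ yt); exists z; rewrite ?inE -?Ez.
  have HB : is_clique B && (B != finset.set0).
    rewrite complete_clique /=.
    by rewrite -card_gt0 -(card_imset _ injpsi) EB card_gt0 bary_vert_neq0.
  by exists (Sub B HB); apply/val_inj; rewrite vf SubK EB.
move=> z; rewrite /facet_int /simplex_int vf !eqEcard subsetT.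
rewrite card_imset // eA cardsT card_ord andTb.
suff -> : psi @: val z \subset val A by [].
by apply/subsetP => _ /imsetP[i _ ->].
Qed.

End FacetStart.

(** * Determinants of Laplacians *)

Section Determinants.
Local Open Scope ring_scope.

(** Sylvester's identity: one block matrix is factored in two ways. *)
Lemma det_one_addM (F : comNzRingType) m n (U : 'M[F]_(m, n)) (V : 'M[F]_(n, m)) :
  \det (1%:M + U *m V) = \det (1%:M + V *m U).
Proof.
pose X := block_mx 1%:M (- U) V 1%:M.
have E1 : X = block_mx 1%:M 0 V 1%:M *m block_mx 1%:M (- U) 0 (1%:M + V *m U).
  rewrite mulmx_block !mul1mx !mul0mx ?mulmx0 ?mulmx1 ?addr0 ?add0r mulmxN.
  by rewrite addrCA addNr addr0.
have E2 : X = block_mx 1%:M (- U) 0 1%:M *m block_mx (1%:M + U *m V) 0 V 1%:M.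
  by rewrite mulmx_block !mul1mx !mul0mx ?mulmx0 ?mulmx1 ?addr0 ?add0r mulNmx addrK.
have := congr1 determinant E1; rewrite {1}E2 !det_mulmx.
by rewrite !det_ublock !det_lblock !det1 !mul1r !mulr1.
Qed.

(** The cross terms vanish, so [1 + \sum K A] is the product of the matrices [1 + K A]. *)
Lemma det_sum_orthogonal (F : comNzRingType) (I : eqType) n (K : I -> 'M[F]_n) (s : seq I) :
  uniq s -> (forall A B, A != B -> K A *m K B = 0) ->
  \det (1%:M + \sum_(A <- s) K A) = \prod_(A <- s) \det (1%:M + K A).
Proof.
move=> + orthK; elim: s => [|A s IHs]; first by rewrite !big_nil addr0 det1.
move=> /= /andP[As us]; rewrite !big_cons -IHs // -det_mulmx.
rewrite mulmxDl mul1mx mulmxDr mulmx1 mulmx_sumr.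
have -> : \sum_(B <- s) K A *m K B = 0.
  by rewrite big_seq big1 // => B Bs; apply: orthK; apply: contraNneq As => ->.
by rewrite addr0 [K A + _]addrC addrA.
Qed.

Lemma sum_vtx (V : nmodType) (G : graph) (f : vert G -> V) :
  \sum_(i < #|vert G|) f (vtx i) = \sum_x f x.
Proof.
by rewrite [RHS](reindex (fun i => vtx i)) //; exists enum_rank => x _;
  rewrite /vtx ?enum_valK ?enum_rankK.
Qed.

Lemma sum_delta (F : pzRingType) (T : finType) (f : T -> F) a :
  \sum_x f x * (x == a)%:R = f a.
Proof.
rewrite (bigD1 a) //= eqxx mulr1 big1 ?addr0 // => x /negbTE->.
by rewrite mulr0.
Qed.

Variable R : realFieldType.

Definition sqnorm n (x : 'cV[R]_n) : R := (x^T *m x) 0 0.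

Lemma sqnormE n (x : 'cV[R]_n) : sqnorm x = \sum_i x i 0 ^+ 2.
Proof. by rewrite /sqnorm mxE; apply: eq_bigr => i _; rewrite mxE expr2. Qed.

Lemma sqnorm_ge0 n (x : 'cV[R]_n) : 0 <= sqnorm x.
Proof. by rewrite sqnormE sumr_ge0 // => i _; apply: sqr_ge0. Qed.

(** The form of [M] dominates that of the identity. This survives the addition of terms
    [c *: (u *m u^T)] with [0 <= c], and it bounds determinants without any appeal to
    eigenvalues. *)
Definition coercive n (M : 'M[R]_n) : Prop :=
  forall x : 'cV_n, sqnorm x <= (x^T *m M *m x) 0 0.

Lemma coercive1 n : coercive (1%:M : 'M[R]_n).
Proof. by move=> x; rewrite mulmx1. Qed.

Lemma coercive_add n (M : 'M[R]_n) c (u : 'cV[R]_n) :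
  0 <= c -> coercive M -> coercive (M + c *: (u *m u^T)).
Proof.
move=> c0 cM x; apply: le_trans (cM x) _.
rewrite mulmxDr mulmxDl [X in _ <= X]mxE lerDl.
rewrite -scalemxAr -scalemxAl mxE mulr_ge0 //.
have -> : x^T *m (u *m u^T) *m x = (u^T *m x)^T *m (u^T *m x).
  by rewrite trmx_mul trmxK !mulmxA.
exact: sqnorm_ge0.
Qed.

(** By Sylvester's identity the determinant is multiplied by [1 + c * u^T M^-1 u], and coercivity
    places [u^T M^-1 u] between [0] and [sqnorm u]. *)
Lemma det_add_rank1 n (M : 'M[R]_n) c (u : 'cV[R]_n) :
  0 <= c -> coercive M -> 0 < \det M ->
  \det M <= \det (M + c *: (u *m u^T)) <= \det M * (1 + c * sqnorm u).
Proof.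
move=> c0 cM dM.
have uM : M \in unitmx by rewrite unitmxE unitfE gt_eqF.
pose y := invmx M *m u.
have Ey : M *m y = u by rewrite mulmxA mulmxV // mul1mx.
have -> : \det (M + c *: (u *m u^T)) = \det M * (1 + c * (u^T *m y) 0 0).
  have -> : M + c *: (u *m u^T) = M *m (1%:M + (c *: y) *m u^T).
    by rewrite mulmxDr mulmx1 mulmxA -scalemxAr Ey -scalemxAl.
  rewrite det_mulmx det_one_addM det_mx11; congr (_ * _).
  by rewrite -scalemxAr !mxE eqxx.
have y1 : sqnorm y <= (u^T *m y) 0 0.
  apply: le_trans (cM y) _.
  have -> : y^T *m M *m y = (u^T *m y)^T by rewrite [in RHS]trmx_mul trmxK -mulmxA Ey.
  by rewrite mxE.
(* Expand [0 <= sqnorm (u - y)] and use that [sqnorm y] is at most [u^T y]. *)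
have y2 : (u^T *m y) 0 0 <= sqnorm u.
  have := sqnorm_ge0 (u - y).
  have -> : sqnorm (u - y) = sqnorm u - 2 * (u^T *m y) 0 0 + sqnorm y.
    rewrite !sqnormE mxE mulr_sumr -sumrB -big_split /=; apply: eq_bigr => i _.
    by rewrite !mxE; ring.
  lra.
have y0 : 0 <= (u^T *m y) 0 0 := le_trans (sqnorm_ge0 y) y1.
apply/andP; split; last by rewrite ler_pM2l // lerD2l ler_wpM2l.
by rewrite -{1}[\det M]mulr1 ler_pM2l // lerDl mulr_ge0.
Qed.

Lemma det_add_gram n (M : 'M[R]_n) c b (s : seq 'cV[R]_n) :
  0 <= c -> (forall u, u \in s -> sqnorm u <= b) -> coercive M -> 0 < \det M ->
  \det M <= \det (M + c *: \sum_(u <- s) u *m u^T) <= \det M * (1 + c * b) ^+ size s.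
Proof.
move=> c0; elim: s M => [|u s IHs] M bs cM dM.
  by rewrite big_nil scaler0 addr0 expr0 mulr1 lexx.
have /andP[l1 l2] := det_add_rank1 u c0 cM dM.
have cM' := coercive_add u c0 cM.
have dM' := lt_le_trans dM l1.
have /andP[l3 l4] : _ <= _ <= _ :=
  IHs _ (fun v vs => bs v (mem_behead (s := u :: s) vs)) cM' dM'.
rewrite big_cons scalerDr addrA (le_trans l1 l3) /=.
apply: le_trans l4 _; rewrite exprS mulrA.
have bu : sqnorm u <= b by apply: bs; rewrite mem_head.
have b0 : 0 <= b := le_trans (sqnorm_ge0 u) bu.
apply: ler_wpM2r; first by rewrite exprn_ge0 // addr_ge0 // mulr_ge0.
by apply: le_trans l2 _; rewrite ler_pM2l // lerD2l ler_wpM2l.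
Qed.

Lemma coercive_gram n (M : 'M[R]_n) c (s : seq 'cV[R]_n) :
  0 <= c -> coercive M -> coercive (M + c *: \sum_(u <- s) u *m u^T).
Proof.
move=> c0; elim: s M => [|u s IHs] M cM; first by rewrite big_nil scaler0 addr0.
by rewrite big_cons scalerDr addrA; apply/IHs/coercive_add.
Qed.

Section Laplacian.
Variable G : graph.

Definition edge_vec (p : vert G * vert G) : 'cV[R]_#|vert G| :=
  \col_i ((vtx i == p.1)%:R - (vtx i == p.2)%:R).

(* [P] ranges over ordered pairs, so a symmetric [P] counts each edge twice; the
   factor [2^-1] compensates for that. *)
Definition laplacian (P : pred (vert G * vert G)) : 'M[R]_#|vert G| :=
  2^-1 *: \sum_(p | P p) edge_vec p *m (edge_vec p)^T.

Lemma edge_vec_dot p q : ((edge_vec p)^T *m edge_vec q) 0 0 =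
  (p.1 == q.1)%:R - (p.1 == q.2)%:R - (p.2 == q.1)%:R + (p.2 == q.2)%:R.
Proof.
rewrite mxE.
pose f x : R := ((x == p.1)%:R - (x == p.2)%:R).
rewrite (eq_bigr (fun i => f (vtx i) * (vtx i == q.1)%:R - f (vtx i) * (vtx i == q.2)%:R)).
  rewrite (sum_vtx (fun x => f x * (x == q.1)%:R - f x * (x == q.2)%:R)) sumrB !sum_delta.
  by rewrite /f ![q.1 == _]eq_sym ![q.2 == _]eq_sym; ring.
by move=> i _; rewrite !mxE /f; ring.
Qed.

Lemma sqnorm_edge_vec p : sqnorm (edge_vec p) <= 2.
Proof.
rewrite /sqnorm edge_vec_dot !eqxx eq_sym.
by case: (_ == _) => /=; lra.
Qed.

Lemma laplacianM (P Q : pred (vert G * vert G)) : (forall p q, P p -> Q q ->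
   [&& p.1 != q.1, p.1 != q.2, p.2 != q.1 & p.2 != q.2]) ->
  laplacian P *m laplacian Q = 0.
Proof.
move=> H; rewrite /laplacian -scalemxAl -scalemxAr mulmx_suml big1 ?scaler0 //.
move=> p Pp; rewrite mulmx_sumr big1 // => q Qq.
have E : (edge_vec p)^T *m edge_vec q = 0.
  apply/matrixP => i j; rewrite !ord1 edge_vec_dot mxE.
  by have /and4P[/negbTE-> /negbTE-> /negbTE-> /negbTE->] := H p q Pp Qq; rewrite !subrr addr0.
by rewrite mulmxA -[_ *m _ *m edge_vec q]mulmxA E mulmx0 mul0mx.
Qed.

(** Edge vectors have squared norm at most [2] and enter with coefficient [c / 2], so each ordered
    pair of [Q] costs a factor of at most [1 + c]. *)
Lemma laplacianU (P Q : pred (vert G * vert G)) c : 0 <= c -> (forall p, P p -> ~~ Q p) ->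
  0 < \det (1%:M + c *: laplacian P) /\
  \det (1%:M + c *: laplacian P) <= \det (1%:M + c *: laplacian (predU P Q))
    <= \det (1%:M + c *: laplacian P) * (1 + c) ^+ #|Q|.
Proof.
move=> c0 PQ.
have c20 : 0 <= c * 2^-1 by rewrite mulr_ge0 // invr_ge0 ler0n.
have EP (S : pred (vert G * vert G)) : c *: laplacian S =
   (c * 2^-1) *: \sum_(u <- [seq edge_vec p | p <- enum S]) u *m u^T.
  by rewrite scalerA big_map big_enum.
have bnd (S : pred (vert G * vert G)) u :
    u \in [seq edge_vec p | p <- enum S] -> sqnorm u <= 2.
  by move=> /mapP[p _ ->]; apply: sqnorm_edge_vec.
have d0 : 0 < \det (1%:M + c *: laplacian P).
  rewrite EP; have := @det_add_gram _ 1%:M _ _ _ c20 (@bnd P) (@coercive1 _).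
  by rewrite det1 => /(_ ltr01)/andP[+ _]; apply: lt_le_trans.
split=> //.
have -> : laplacian (predU P Q) = laplacian P + laplacian Q.
  rewrite /laplacian -scalerDr; congr (_ *: _).
  rewrite (bigID P) /=; congr (_ + _); apply: eq_bigl => p /=.
    by case: (P p); rewrite ?andbF.
  by have := PQ p; case: (P p) => /=; [move/(_ isT)/negbTE->|rewrite andbT].
have cP : coercive (1%:M + c *: laplacian P).
  by rewrite EP; apply: coercive_gram => //; apply: coercive1.
rewrite scalerDr addrA (EP Q).
have := det_add_gram c20 (@bnd Q) cP d0.
have -> : c * 2^-1 * 2 = c by field.
by rewrite size_map -cardE.
Qed.

(** Expanding the product of differences gives two degree terms and two adjacency terms. Symmetry
    makes each pair equal, and [2^-1] halves it. *)
Lemma laplacian_adjE (i j : 'I_#|vert G|) : simple_graph G ->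
  laplacian (fun p => adj p.1 p.2) i j =
  if i == j then #|[set y | adj (vtx i) y]|%:R else - ((adj (vtx i) (vtx j) : nat)%:R).
Proof.
move=> [symG irrG]; rewrite /laplacian mxE summxE.
pose a (x y : vert G) : R := (adj x y)%:R.
pose x := vtx i; pose y := vtx j.
rewrite (eq_bigr (fun p : vert G * vert G =>
   ((x == p.1)%:R - (x == p.2)%:R) * ((y == p.1)%:R - (y == p.2)%:R))); last first.
  by move=> p _; rewrite mxE big_ord1 !mxE.
rewrite -(pair_big_dep xpredT (fun u v => adj u v) (fun u v =>
   ((x == u)%:R - (x == v)%:R) * ((y == u)%:R - (y == v)%:R))) /=.
have -> : \sum_u \sum_(v | adj u v) ((x == u)%:R - (x == v)%:R) * ((y == u)%:R - (y == v)%:R)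
  = \sum_u ((\sum_v a u v) * (y == u)%:R) * (u == x)%:R
    + \sum_v ((\sum_u a u v) * (y == v)%:R) * (v == x)%:R
    - \sum_u (\sum_v a u v * (v == y)%:R) * (u == x)%:R
    - \sum_u (\sum_v a u v * (v == x)%:R) * (u == y)%:R.
  have -> : \sum_v ((\sum_u a u v) * (y == v)%:R) * (v == x)%:R
    = \sum_u \sum_v a u v * ((y == v)%:R * (v == x)%:R).
    by rewrite exchange_big; apply: eq_bigr => v _; rewrite -mulrA mulr_suml.
  rewrite -big_split -!sumrB; apply: eq_bigr => u _ /=.
  rewrite !mulr_suml -big_split -!sumrB big_mkcond; apply: eq_bigr => v _ /=.
  rewrite /a ![_ == x]eq_sym ![_ == y]eq_sym.
  case: (adj u v) => /=; last by rewrite !mul0r !addr0 !subr0.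
  move: ((x == u)%:R : R) ((x == v)%:R : R) ((y == u)%:R : R) ((y == v)%:R : R).
  by move=> *; ring.
rewrite !sum_delta.
have degx : \sum_v a x v = #|[set v | adj x v]|%:R.
  rewrite -sum1dep_card natr_sum [RHS]big_mkcond; apply: eq_bigr => v _.
  by rewrite /a; case: (adj x v).
have -> : \sum_u a u x = \sum_v a x v by apply: eq_bigr => u _; rewrite /a symG.
rewrite degx (inj_eq enum_val_inj) eq_sym /a [adj y x]symG.
have [eij|_] := eqVneq i j; last by rewrite /=; field.
by rewrite /y -eij irrG /=; field.
Qed.

End Laplacian.

Section Embedding.
Variables (G D : graph) (phi : vert D -> vert G).
Hypothesis phi_inj : injective phi.

Definition embed_mx : 'M[R]_(#|vert G|, #|vert D|) :=
  \matrix_(i, j) (vtx i == phi (vtx j))%:R.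

Lemma embed_mxK : embed_mx^T *m embed_mx = 1%:M.
Proof.
apply/matrixP => i j; rewrite !mxE.
rewrite (eq_bigr (fun k => (fun x => (x == phi (vtx i))%:R * (x == phi (vtx j))%:R) (vtx k))).
  rewrite (sum_vtx (fun x : vert G => (x == phi (vtx i))%:R * (x == phi (vtx j))%:R)) sum_delta.
  by rewrite (inj_eq phi_inj) (inj_eq (enum_val_inj)) eq_sym.
by move=> k _; rewrite !mxE.
Qed.

Lemma embed_edge_vec p : embed_mx *m edge_vec p = edge_vec (phi p.1, phi p.2).
Proof.
apply/matrixP => i j; rewrite !mxE.
pose f x : R := (vtx i == phi x)%:R.
rewrite (eq_bigr (fun k => (fun x => f x * (x == p.1)%:R - f x * (x == p.2)%:R) (vtx k))).
  by rewrite (sum_vtx (fun x : vert D => f x * (x == p.1)%:R - f x * (x == p.2)%:R)) sumrB !sum_delta.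
by move=> k _; rewrite !mxE mulrBr.
Qed.

(** The columns of [embed_mx] are orthonormal, so by Sylvester's identity the vertices outside the
    image only contribute factors [1]. *)
Lemma det_laplacian_embed (P : pred (vert D * vert D)) (Q : pred (vert G * vert G)) c :
  (forall p, Q (phi p.1, phi p.2) = P p) ->
  (forall q, Q q -> exists p, q = (phi p.1, phi p.2)) ->
  \det (1%:M + c *: laplacian Q) = \det (1%:M + c *: laplacian P).
Proof.
move=> QP Qim.
pose f (p : vert D * vert D) := (phi p.1, phi p.2).
have finj : injective f by move=> [a b] [a' b'] [/phi_inj -> /phi_inj ->].
have -> : laplacian Q = embed_mx *m laplacian P *m embed_mx^T.
  rewrite /laplacian -scalemxAr -scalemxAl; congr (_ *: _).
  have EQ : Q =1 mem (f @: [set p | P p]).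
    move=> q; apply/idP/imsetP => [Qq|[p]]; last by rewrite inE -QP => Pp ->.
    by have [p Ep] := Qim q Qq; exists p => //; rewrite inE -QP -Ep.
  rewrite (eq_bigl _ _ EQ) big_imset /=; last by move=> ? ? _ _; apply: finj.
  rewrite mulmx_sumr mulmx_suml; apply: eq_big => p; first by rewrite inE.
  by move=> _; rewrite -embed_edge_vec trmx_mul !mulmxA.
by rewrite -mulmxA scalemxAr det_one_addM -scalemxAl -mulmxA embed_mxK // mulmx1.
Qed.

End Embedding.
End Determinants.

(** * Additivity of determinants over the facets *)

Section FacetComparison.
Local Open Scope ring_scope.
Variable R : realFieldType.

Definition full_laplacian (G : graph) : 'M[R]_#|vert G| :=
  laplacian R (fun p => adj p.1 p.2).

Definition inner_edges (G : graph) (int : pred (vert G)) : pred (vert G * vert G) :=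
  fun p => [&& adj p.1 p.2, int p.1 & int p.2].

Lemma eq_laplacian (G : graph) (P Q : pred (vert G * vert G)) :
  P =1 Q -> laplacian R P = laplacian R Q.
Proof. by move=> PQ; rewrite /laplacian (eq_bigl _ _ PQ). Qed.

Lemma det_full_laplacian_inner (G : graph) (int : pred (vert G)) c : 0 <= c ->
  let X := \det (1%:M + c *: laplacian R (inner_edges int)) in
  0 < X /\ X <= \det (1%:M + c *: full_laplacian G) <= X * (1 + c) ^+ #|bad_edges int|.
Proof.
move=> c0 X.
have H p : inner_edges int p -> ~~ [pred q | q \in bad_edges int] p.
  by rewrite /inner_edges !inE => /and3P[-> -> ->].
have [X0] := laplacianU c0 H.
rewrite (_ : laplacian R (predU _ _) = full_laplacian G).
  by rewrite (eq_card (B := mem (bad_edges int))).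
apply: eq_laplacian => p /=; rewrite /inner_edges !inE.
by case: (adj _ _); case: (int _); case: (int _).
Qed.

Variables (I : finType) (G : graph) (intG : I -> pred (vert G)).
Hypothesis sepG : separated intG.

(** By separation, an edge with two interior ends has both of them in the interior of the same,
    unique, facet. *)
Lemma laplacian_facets :
  laplacian R (inner_edges (fun x => [exists A, intG A x])) =
  \sum_A laplacian R (inner_edges (intG A)).
Proof.
rewrite /laplacian -scaler_sumr; congr (_ *: _).
rewrite (exchange_big_dep (inner_edges (fun x => [exists A, intG A x]))) /=; last first.
  move=> A p _ /and3P[ap ix iy]; apply/and3P; split=> //; apply/existsP; by exists A.
apply: eq_bigr => p /and3P[ap /existsP[A iA] /existsP[B iB]].
have EB : B = A by apply/esym/(sepG iA iB); rewrite ap orbT.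
rewrite (big_pred1 A) // => C; apply/and3P/eqP => [[_ iC _]|->].
  by apply: (sepG iC iA); rewrite eqxx.
by rewrite -{2}EB.
Qed.

Variables (D : graph) (intD : pred (vert D)).
Hypothesis embG : forall A, exists phi, facet_embedding (intG A) intD phi.

Lemma det_facets c :
  \det (1%:M + c *: laplacian R (inner_edges (fun x => [exists A, intG A x]))) =
  \det (1%:M + c *: laplacian R (inner_edges intD)) ^+ #|I|.
Proof.
rewrite laplacian_facets scaler_sumr det_sum_orthogonal ?index_enum_uniq //.
  rewrite (eq_bigr (fun=> \det (1%:M + c *: laplacian R (inner_edges intD)))).
    by rewrite prodr_const.
  move=> A _; have [phi [injphi adjphi imphi intphi]] := embG A.
  apply: (det_laplacian_embed injphi) => [p|[x y]].
    by rewrite /inner_edges /= adjphi !intphi.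
  move=> /and3P[/= _ ix iy].
  have [u ->] := imphi x x ix (predU1l _ erefl).
  by have [v ->] := imphi y y iy (predU1l _ erefl); exists (u, v).
move=> A B nAB; rewrite -scalemxAl -scalemxAr laplacianM ?scaler0 //.
move=> p q /and3P[_ px py] /and3P[_ qx qy].
have sep x y : intG A x -> intG B y -> x != y.
  by move=> iA iB; apply: contra_neq nAB => xy; apply: (sepG iA iB); rewrite xy eqxx.
by rewrite !sep.
Qed.

Lemma card_int_facets :
  #|[set x | [exists A, intG A x]]| = (#|I| * #|[set x | intD x]|)%N.
Proof.
rewrite -sum_nat_const -sum1dep_card.
transitivity (\sum_(x | [exists A, intG A x]) \sum_(A | intG A x) 1)%N.
  apply: eq_bigr => x /existsP[A iA].
  rewrite (big_pred1 A) // => B; apply/idP/eqP => [iB|-> //].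
  by apply: (sepG iB iA); rewrite eqxx.
rewrite (exchange_big_dep xpredT) //=; apply: eq_bigr => A _.
have [phi [injphi adjphi imphi intphi]] := embG A.
rewrite (eq_bigl (intG A)); last first.
  by move=> x /=; apply/andP/idP => [[]|iA] //; split=> //; apply/existsP; exists A.
rewrite sum1dep_card -(card_imset _ injphi); congr #|pred_of_set _|.
apply/setP => x; rewrite inE; apply/idP/imsetP => [iA|[z]].
  have [z Ez] := imphi x x iA (predU1l _ erefl).
  by exists z => //; rewrite inE -intphi -Ez.
by rewrite inE -intphi => iz ->.
Qed.

End FacetComparison.

(** * Spectrum of the Kirchhoff matrix *)

Section Spectrum.
Local Open Scope ring_scope.
Variables (R : realType) (G : graph).
Hypothesis simG : simple_graph G.
Local Notation C := R[i].
Local Notation N := #|vert G|.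
Local Notation K := (kirchhoff R G).
Local Notation toC := (real_complex R).

Lemma kirchhoff_map : K = map_mx toC (full_laplacian R G).
Proof.
apply/matrixP => i j; rewrite [RHS]mxE laplacian_adjE // mxE /degree.
by case: (i == j); rewrite ?rmorphN rmorph_nat.
Qed.

Definition coord (v : 'rV[C]_N) (x : vert G) : C := v 0 (enum_rank x).

Lemma mulmx_edge_vec (v : 'rV[C]_N) p :
  v *m map_mx toC (edge_vec R p) = (coord v p.1 - coord v p.2)%:M.
Proof.
apply/matrixP => i j; rewrite !ord1 !mxE eqxx mulr1n.
rewrite (eq_bigr (fun k => (fun x => coord v x * (x == p.1)%:R - coord v x * (x == p.2)%:R) (vtx k))).
  rewrite (sum_vtx (fun x => coord v x * (x == p.1)%:R - coord v x * (x == p.2)%:R)).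
  by rewrite sumrB !sum_delta.
by move=> k _; rewrite /coord /vtx enum_valK !mxE rmorphB !rmorph_nat mulrBr.
Qed.

Lemma mulmx_kirchhoff (v : 'rV[C]_N) : v *m K =
  2^-1 *: \sum_(p | adj p.1 p.2) (coord v p.1 - coord v p.2) *: (map_mx toC (edge_vec R p))^T.
Proof.
rewrite kirchhoff_map /full_laplacian /laplacian map_mxZ raddf_sum -scalemxAr.
rewrite fmorphV rmorph_nat mulmx_sumr; congr (_ *: _); apply: eq_bigr => p _.
by rewrite /= map_mxM mulmxA mulmx_edge_vec mul_scalar_mx map_trmx.
Qed.

Definition energy (v : 'rV[C]_N) : C :=
  2^-1 * \sum_(p | adj p.1 p.2) `|coord v p.1 - coord v p.2| ^+ 2.

Definition mass (v : 'rV[C]_N) : C := \sum_x `|coord v x| ^+ 2.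

Definition conj_row (v : 'rV[C]_N) : 'cV[C]_N := (map_mx Num.conj v)^T.

Lemma mulmx_conj_row (v : 'rV[C]_N) : (v *m conj_row v) 0 0 = mass v.
Proof.
rewrite mxE /mass -sum_vtx; apply: eq_bigr => i _.
by rewrite /coord /vtx enum_valK !mxE normCK.
Qed.

Lemma energyE (v : 'rV[C]_N) : (v *m K *m conj_row v) 0 0 = energy v.
Proof.
rewrite mulmx_kirchhoff -scalemxAl mxE mulmx_suml summxE; congr (_ * _).
apply: eq_bigr => p _; rewrite -scalemxAl mxE -trmx_mul mxE mulmx_edge_vec mxE eqxx mulr1n.
have cE x : coord (map_mx Num.conj v) x = Num.conj (coord v x) by rewrite /coord mxE.
by rewrite !cE -rmorphB normCK.
Qed.

Lemma energy_ge0 v : 0 <= energy v.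
Proof. by rewrite mulr_ge0 ?invr_ge0 // sumr_ge0 // => p _; rewrite exprn_ge0. Qed.

Lemma mass_gt0 v : v != 0 -> 0 < mass v.
Proof.
move=> v0; rewrite lt_def sumr_ge0 ?andbT; last by move=> ? _; rewrite exprn_ge0.
apply: contraNneq v0 => /eqP; rewrite psumr_eq0; last by move=> ? _; rewrite exprn_ge0.
move=> /allP H; apply/eqP/rowP => i; rewrite mxE -(enum_valK i).
have := H (enum_val i) (mem_index_enum _).
by rewrite sqrf_eq0 normr_eq0 => /eqP.
Qed.

(** Both orientations of the edge occur in the sum, which makes up for the factor [2^-1]. *)
Lemma energy_edge v x y : adj x y -> `|coord v x - coord v y| ^+ 2 <= energy v.
Proof.
move=> xy; have [symG irrG] := simG.
have nxy : x != y by apply: contraTneq xy => ->; rewrite irrG.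
rewrite /energy (bigD1 (x, y)) //= (bigD1 (y, x)) /=; last first.
  by rewrite symG xy xpair_eqE eq_sym (negbTE nxy).
rewrite [`|coord v y - _|]distrC; set a := `|_| ^+ 2; set r := \sum_(_ | _) _.
have -> : 2^-1 * (a + (a + r)) = a + 2^-1 * r by field.
by rewrite lerDl mulr_ge0 ?invr_ge0 // sumr_ge0 // => p _; rewrite exprn_ge0.
Qed.

Lemma eigen_energy v z : v *m K = z *: v -> z * mass v = energy v.
Proof. by move=> vK; rewrite -energyE vK -scalemxAl mxE mulmx_conj_row. Qed.

Lemma eigenvalue_ge0 z : eigenvalue K z -> 0 <= z.
Proof.
move=> /eigenvalueP[v vK v0]; have m0 := mass_gt0 v0.
by rewrite -(pmulr_lge0 _ m0) (eigen_energy vK) energy_ge0.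
Qed.

Lemma coord_connect v x y D :
  (forall a b, adj a b -> `|coord v a - coord v b| <= D) -> 0 <= D ->
  connect (@adj G) x y -> `|coord v x - coord v y| <= N%:R * D.
Proof.
move=> edgeD D0 /connectP[p0 pp0 ->]; case/shortenP: pp0 => p pp up _ {p0}.
have sp : (size p <= N)%N.
  have := card_uniqP up; rewrite /= => cp.
  by apply: ltnW; rewrite -cp max_card.
apply: (@le_trans _ _ ((size p)%:R * D)); last by rewrite ler_wpM2r // ler_nat.
elim: p x pp {up sp} => [|a p IHp] x /=; first by rewrite subrr normr0 mul0r.
move=> /andP[xa /IHp IH].
have -> : coord v x - coord v (last a p)
  = (coord v x - coord v a) + (coord v a - coord v (last a p)) by ring.
apply: le_trans (ler_normD _ _) _.
by rewrite -natr1 mulrDl mul1r addrC lerD // edgeD.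
Qed.

(** The two ends of an edge lie in one component, so [v *m K] sums to [0] on every component; divide
    by [z]. *)
Lemma sum_component v z x : v *m K = z *: v -> z != 0 ->
  \sum_(y | connect (@adj G) x y) coord v y = 0.
Proof.
move=> vK z0; have [symG irrG] := simG.
have csym := sym_connect_sym symG.
apply: (mulfI z0); rewrite mulr0 mulr_sumr.
have cE y : z * coord v y = 2^-1 * \sum_(p | adj p.1 p.2)
    (coord v p.1 - coord v p.2) * ((y == p.1)%:R - (y == p.2)%:R).
  have -> : z * coord v y = coord (v *m K) y by rewrite vK /coord !mxE.
  rewrite mulmx_kirchhoff /coord mxE summxE; congr (_ * _); apply: eq_bigr => p _.
  by rewrite !mxE rmorphB !rmorph_nat /vtx enum_rankK.
rewrite (eq_bigr _ (fun y _ => cE y)) -mulr_sumr exchange_big big1 ?mulr0 //= => p ap.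
rewrite -mulr_sumr sumrB.
have cnt q : \sum_(y | connect (@adj G) x y) (y == q)%:R = (connect (@adj G) x q)%:R :> C.
  rewrite big_mkcond /=; rewrite -[RHS](sum_delta (fun y => (connect (@adj G) x y)%:R)).
  by apply: eq_bigr => y _; case: (connect _ _ _); rewrite ?mul1r ?mul0r.
rewrite !cnt (same_connect_r csym (connect1 ap)) subrr mulr0 //.
Qed.

(* The coordinates of an eigenvector for [z != 0] sum to [0] on the component of
   [x], so the coordinate at [x] is the mean of its differences with the others,
   each of them a sum of at most [N] differences along edges. *)
Lemma eigenvalue_gap z : eigenvalue K z -> z != 0 -> 1 <= N%:R ^+ 3 * z.
Proof.
move=> ez z0; have zge0 := eigenvalue_ge0 ez.
have /eigenvalueP[v vK v0] := ez; have m0 := mass_gt0 v0.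
have Ev := eigen_energy vK.
pose D := sqrtC (energy v).
have D0 : 0 <= D by rewrite sqrtC_ge0 energy_ge0.
have DD : D ^+ 2 = energy v by rewrite sqrtCK.
have edgeD a b : adj a b -> `|coord v a - coord v b| <= D.
  move=> ab; rewrite -(@ler_pXn2r _ 2) ?nnegrE // DD; exact: energy_edge.
have bound x : `|coord v x| <= N%:R * D.
  pose S := [set y | connect (@adj G) x y].
  have S0 : (0 < #|S|)%N by apply/card_gt0P; exists x; rewrite inE connect0.
  have S0C : 0 < #|S|%:R :> C by rewrite ltr0n.
  rewrite -(ler_pM2l S0C) -[X in X * `|_|]ger0_norm ?ler0n // -normrM.
  have -> : #|S|%:R * coord v x = \sum_(y | connect (@adj G) x y) (coord v x - coord v y).
    rewrite sumrB (sum_component x vK z0) subr0 sumr_const mulr_natl.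
    by congr (_ *+ _); apply: eq_card => y; rewrite !inE.
  apply: le_trans (ler_norm_sum _ _ _) _.
  apply: (@le_trans _ _ (\sum_(y | connect (@adj G) x y) N%:R * D)).
    by apply: ler_sum => y cxy; apply: coord_connect.
  rewrite sumr_const -[X in X <= _]mulr_natl.
  rewrite le_eqVlt; apply/orP; left; apply/eqP.
  by congr (_%:R * _); apply: eq_card => y; rewrite !inE.
(* Squaring the bound and summing over the vertices gives [mass v <= N ^ 3 * energy v], and the
   energy is [z * mass v]. *)
rewrite -(ler_pM2r m0) mul1r -mulrA Ev -DD.
apply: (@le_trans _ _ (\sum_(x : vert G) (N%:R * D) ^+ 2)).
  by apply: ler_sum => x _; rewrite ler_pXn2r ?nnegrE ?mulr_ge0.
rewrite sumr_const -[_ *+ _]mulr_natl exprMn mulrA -exprS.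
by [].
Qed.

Lemma char_poly_eigenvalues : char_poly K = \prod_(z <- eigenvalues K) ('X - z%:P).
Proof.
rewrite /eigenvalues; case: closed_field_poly_normal => r /= {1}->.
by rewrite (monicP (char_poly_monic _)) scale1r.
Qed.

Lemma mem_eigenvalues z : (z \in eigenvalues K) = eigenvalue K z.
Proof. by rewrite eigenvalue_root_char char_poly_eigenvalues root_prod_XsubC. Qed.

End Spectrum.

(** * Real spectrum and multiplicity of the eigenvalue zero *)

Section Multiplicity.
Local Open Scope ring_scope.

Lemma mup_prod_XsubC (F : fieldType) (s : seq F) x :
  mup x (\prod_(z <- s) ('X - z%:P)) = count_mem x s.
Proof.
elim: s => [|z s IHs].
  by rewrite big_nil mupNroot // root1.
rewrite big_cons mupM ?polyXsubC_eq0 ?IHs //=.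
  by rewrite -[_ - _]expr1 mup_XsubCX; case: eqP.
by rewrite monic_neq0 // monic_prod_XsubC.
Qed.

Lemma perm_eq_prod_XsubC (F : fieldType) (s t : seq F) :
  \prod_(z <- s) ('X - z%:P) = \prod_(z <- t) ('X - z%:P) -> perm_eq s t.
Proof.
by move=> st; apply/allP => x _ /=; rewrite -!mup_prod_XsubC st.
Qed.

Lemma char_poly_diag_similar (F : fieldType) n (P : 'M[F]_n) (d : 'rV[F]_n) :
  P \in unitmx -> char_poly (invmx P *m diag_mx d *m P) = \prod_i ('X - (d 0 i)%:P).
Proof.
move=> uP; rewrite /char_poly.
have -> : char_poly_mx (invmx P *m diag_mx d *m P) =
   map_mx polyC (invmx P) *m char_poly_mx (diag_mx d) *m map_mx polyC P.
  rewrite /char_poly_mx mulmxBr mulmxBl -!map_mxM; congr (_ - _).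
  by rewrite scalar_mxC -mulmxA -map_mxM mulVmx // map_mx1 mulmx1.
rewrite !det_mulmx mulrAC -det_mulmx -map_mxM mulVmx // map_mx1 det1 mul1r.
rewrite -/(char_poly _) char_poly_trig ?diag_mx_is_trig //.
by apply: eq_bigr => i _; rewrite mxE eqxx mulr1n.
Qed.

Lemma mxrank_diag_le (F : fieldType) n (d : 'rV[F]_n) :
  (\rank (diag_mx d) <= #|[set i | d 0%R i != 0%R]|)%N.
Proof.
rewrite diag_mx_sum_delta (bigID (fun i => d 0 i != 0)) /= [X in _ + X]big1 ?addr0.
  rewrite -sum1dep_card.
  elim/big_ind2: _ => [|A a B b lA lB|i _]; first by rewrite mxrank0.
    exact: leq_trans (mxrank_add _ _) (leq_add lA lB).
  by apply: leq_trans (mxrank_scale _ _) _; rewrite mxrank_delta.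
by move=> i; rewrite negbK => /eqP->; rewrite scale0r.
Qed.

Variables (R : realType) (G : graph).
Hypothesis simG : simple_graph G.
Local Notation C := R[i].
Local Notation N := #|vert G|.
Local Notation K := (kirchhoff R G).

Lemma kirchhoff_normal : K \is normalmx.
Proof.
apply/hermitian_normalmx/is_hermitianmxP.
rewrite expr0 scale1r; apply/matrixP => i j; rewrite !mxE.
have [symG irrG] := simG.
rewrite eq_sym; case: eqVneq => [->|_]; first by rewrite rmorph_nat.
by rewrite rmorphN rmorph_nat symG.
Qed.

(** The spectral theorem diagonalizes the Hermitian matrix [K]. Unique factorization of the
    characteristic polynomial then matches the diagonal with [eigenvalues], including
    multiplicities. *)
Lemma eigenvalues_diag : exists d : 'rV[C]_N,
  perm_eq (eigenvalues K) [seq d 0 i | i <- enum 'I_N] /\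
  exists2 P, P \in unitmx & K = invmx P *m diag_mx d *m P.
Proof.
have KE := orthomx_spectralP kirchhoff_normal; have uP := spectral_unit K.
exists (spectral_diag K); split; last by exists (spectralmx K).
apply: perm_eq_prod_XsubC; rewrite -(char_poly_eigenvalues R G) {1}KE.
by rewrite char_poly_diag_similar // big_map big_enum.
Qed.

Lemma det_add_kirchhoff t : \det (t%:M + K) = \prod_(z <- eigenvalues K) (t + z).
Proof.
have [d [pd [P uP KE]]] := eigenvalues_diag.
rewrite (perm_big _ pd) big_map big_enum /= {1}KE.
have -> : t%:M + invmx P *m diag_mx d *m P = invmx P *m (t%:M + diag_mx d) *m P.
  by rewrite mulmxDr mulmxDl scalar_mxC -[t%:M *m _ *m _]mulmxA mulVmx // mulmx1.
rewrite !det_mulmx mulrAC -det_mulmx mulVmx // det1 mul1r.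
have -> : t%:M + diag_mx d = diag_mx (const_mx t + d) by rewrite linearD /= diag_const_mx.
by rewrite det_diag; apply: eq_bigr => i _; rewrite !mxE.
Qed.

Definition hitting (G : graph) (S : {set vert G}) : Prop :=
  forall x, exists2 y, y \in S & connect (@adj G) x y.

(* Adding the indicator of [S] to the diagonal of [K] makes it invertible. *)
Lemma zero_multiplicity (S : {set vert G}) :
  hitting S -> (count_mem 0%R (eigenvalues K) <= #|S|)%N.
Proof.
move=> hitS; have [d [pd [P uP KE]]] := eigenvalues_diag.
pose D : 'M[C]_N := diag_mx (\row_i (vtx i \in S)%:R).
have uKD : K + D \in unitmx.
  rewrite unitmxE unitfE; apply/negP => /det0P[v v0 vKD].
  (* For a kernel vector both nonnegative terms vanish: [v] is constant on components and zero on
     [S], which meets every component. *)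
  have E0 : energy v + \sum_(x in S) `|coord v x| ^+ 2 = 0.
    rewrite -energyE //.
    have -> : \sum_(x in S) `|coord v x| ^+ 2 = (v *m D *m conj_row v) 0 0.
      rewrite mxE big_mkcond /= -(sum_vtx (fun x => if x \in S then `|coord v x| ^+ 2 else 0)).
      apply: eq_bigr => i _; rewrite mul_mx_diag !mxE /coord /vtx enum_valK.
      by case: ifP => _; rewrite ?mulr1 ?normCK // mulr0 mul0r.
    transitivity ((v *m (K + D) *m conj_row v) 0 0); last by rewrite vKD mul0mx mxE.
    by rewrite mulmxDr mulmxDl [RHS]mxE.
  have S0 : 0 <= \sum_(x in S) `|coord v x| ^+ 2.
    by apply: sumr_ge0 => x _; rewrite exprn_ge0.
  have e0 : energy v = 0.
    by apply/le_anti; rewrite energy_ge0 andbT -E0 lerDl.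
  have s0 x : x \in S -> coord v x = 0.
    move: E0; rewrite e0 add0r => /eqP.
    rewrite psumr_eq0; last by move=> y _; rewrite exprn_ge0.
    move=> /allP/(_ x (mem_index_enum _))/implyP H /H.
    by rewrite sqrf_eq0 normr_eq0 => /eqP.
  have c0 x : coord v x = 0.
    have [y yS cxy] := hitS x.
    have : `|coord v x - coord v y| <= N%:R * 0.
      apply: (coord_connect _ (lexx 0) cxy) => a b ab.
      rewrite -(@ler_pXn2r _ 2) ?nnegrE //.
      have -> : 0 ^+ 2 = energy v by rewrite expr0n e0.
      exact: energy_edge.
    by rewrite mulr0 (s0 y yS) subr0 normr_le0 => /eqP.
  move/negP: v0; apply; apply/eqP/rowP => i; rewrite mxE -(enum_valK i).
  exact: c0.
have rK : (\rank K <= #|[set i | d 0%R i != 0%R]|)%N.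
  rewrite KE; apply: leq_trans (mxrankM_maxl _ _) _.
  apply: leq_trans (mxrankM_maxr _ _) _; exact: mxrank_diag_le.
have rD : (\rank D <= #|S|)%N.
  apply: leq_trans (mxrank_diag_le _) _.
  rewrite -(card_imset _ (@enum_val_inj _ _)); apply: subset_leq_card.
  apply/subsetP => x /imsetP[k]; rewrite inE mxE pnatr_eq0 eqb0 negbK => kS ->.
  exact: kS.
(* The invertible sum has rank [N], so the rank of [K], hence the number of nonzero eigenvalues, is
   at least [N - #|S|]. *)
have le : (N <= #|[set i | d 0%R i != 0%R]| + #|S|)%N.
  by rewrite -{1}(mxrank_unit uKD) (leq_trans (mxrank_add _ _)) // leq_add.
rewrite (permP pd) count_map.
have -> : count (preim (fun i => d 0%R i) (pred1 0%R)) (enum 'I_N) = #|[set i | d 0%R i == 0%R]|.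
  by rewrite -sum1_count big_enum_cond -sum1dep_card; apply: eq_bigl => k.
rewrite -(leq_add2l #|[set i | d 0%R i != 0%R]|) (leq_trans _ le) //.
rewrite -[X in (_ <= X)%N]card_ord -(cardsC [set i | d 0%R i != 0%R]).
by apply: eq_leq; congr (_ + _)%N; apply: eq_card => i; rewrite !inE negbK.
Qed.

(** Restates over the reals all that the analytic part needs from the complex spectrum. *)
Lemma kirchhoff_spectrum (S : {set vert G}) : hitting S ->
  exists lam : seq R,
  [/\ size lam = N,
      (forall l, l \in lam -> l = 0 \/ (0 < l /\ 1 <= N%:R ^+ 3 * l)),
      (forall t, \det (t%:M + full_laplacian R G) = \prod_(l <- lam) (t + l)),
      (count_mem 0%R lam <= #|S|)%N &
      complex.Re (tree_forest_ratio R G)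
        = (\prod_(l <- lam) (1 + l)) / \prod_(l <- lam | l != 0) l].
Proof.
move=> hitS.
pose lam := [seq complex.Re z | z <- eigenvalues K].
have realE : eigenvalues K = [seq real_complex R l | l <- lam].
  rewrite -map_comp -[LHS]map_id; apply/eq_in_map => z.
  by rewrite mem_eigenvalues => /(eigenvalue_ge0 simG)/ger0_Im; case: z => a b /= ->.
have eC l : l \in lam -> eigenvalue K (real_complex R l).
  by move=> ll; rewrite -mem_eigenvalues realE map_f.
have slam : size lam = N.
  have := congr1 (fun p : {poly C} => size p) (char_poly_eigenvalues R G).
  by rewrite size_char_poly size_prod_XsubC size_map => -[].
clearbody lam; exists lam; split=> //.
- move=> l /eC el; have [->|l0] := eqVneq l 0; [by left|right].
  have l0' : real_complex R l != 0 by rewrite (inj_eq (@complexI R)).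
  have := eigenvalue_ge0 simG el; have := eigenvalue_gap simG el l0'.
  rewrite -[1]/(real_complex R 1) -(rmorph_nat (real_complex R)) -rmorphXn -rmorphM !lecR => ? ?.
  by split=> //; rewrite lt_def l0.
- move=> t; apply: (@complexI R); rewrite -det_map_mx map_mxD map_scalar_mx.
  rewrite -(kirchhoff_map R simG) det_add_kirchhoff realE big_map rmorph_prod.
  by apply: eq_bigr => l _; rewrite rmorphD.
- apply: leq_trans (zero_multiplicity hitS); rewrite realE [X in (_ <= X)%N]count_map.
  by rewrite (eq_count (a2 := pred1 0)) // => l /=; rewrite (inj_eq (@complexI R)).
- rewrite /tree_forest_ratio det_add_kirchhoff /pdet realE !big_map.
  have -> : \prod_(l <- lam) (1 + real_complex R l) = real_complex R (\prod_(l <- lam) (1 + l)).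
    by rewrite rmorph_prod; apply: eq_bigr => l _; rewrite rmorphD rmorph1.
  have -> : \prod_(l <- lam | real_complex R l != 0) real_complex R l
    = real_complex R (\prod_(l <- lam | l != 0) l).
    by rewrite rmorph_prod; apply: eq_bigl => l; rewrite (inj_eq (@complexI R)).
  by rewrite -fmorph_div.
Qed.

End Multiplicity.

(** * Vertex sets meeting every component *)

Section HittingSets.

(** The singletons of [S] do: a path of [G] lifts to singletons joined through its edges, and every
    simplex is joined to the singletons of its vertices. *)
Lemma hitting_bary (G : graph) (S : {set vert G}) : simple_graph G -> hitting S ->
  exists2 S' : {set vert (bary G)}, #|S'| <= #|S| & hitting S'.
Proof.
move=> [symG irrG] hitS.
have cl1 (x : vert G) : is_clique [set x] && ([set x] != finset.set0).
  rewrite -card_gt0 cards1 andbT; apply/is_cliqueP => y z.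
  by rewrite !inE => /eqP-> /eqP->; rewrite eqxx.
pose sing (x : vert G) : vert (bary G) := Sub [set x] (cl1 x).
have sub_connect (s t : vert (bary G)) :
    val s \subset val t -> connect (@adj (bary G)) s t /\ connect (@adj (bary G)) t s.
  move=> st; have [->|nst] := eqVneq s t; first by rewrite connect0.
  have pst : val s \proper val t by rewrite properEneq st andbT.
  by split; apply: connect1; rewrite /adj /= /bary_adj pst ?orbT.
have edge x y : adj x y -> connect (@adj (bary G)) (sing x) (sing y).
  move=> xy; have nxy : x != y by apply: contraTneq xy => ->; rewrite irrG.
  have cl2 : is_clique [set x; y] && ([set x; y] != finset.set0).
    rewrite -card_gt0 cards2 nxy andbT; apply/is_cliqueP => u v.
    by rewrite !inE => /orP[]/eqP-> /orP[]/eqP->; rewrite ?eqxx // symG.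
  pose e : vert (bary G) := Sub [set x; y] cl2.
  have [|c1 _] := sub_connect (sing x) e.
    by rewrite !SubK finset.sub1set !inE eqxx.
  have [|_ c2] := sub_connect (sing y) e.
    by rewrite !SubK finset.sub1set !inE eqxx orbT.
  exact: connect_trans c1 c2.
exists (sing @: S); first exact: leq_imset_card.
move=> s; have /set0Pn[x xs] := bary_vert_neq0 s.
have [y yS /connectP[p pp Ey]] := hitS x.
exists (sing y); first exact: imset_f.
have [|_ c1] := sub_connect (sing x) s; first by rewrite SubK finset.sub1set.
apply: connect_trans c1 _; rewrite {y yS}Ey.
elim: p x pp {xs} => [|a p IHp] x /=; first by rewrite connect0.
by move=> /andP[/edge xa /IHp]; apply: connect_trans.
Qed.

Lemma bary_iter_simple n (G : graph) : simple_graph G -> simple_graph (bary_iter n G).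
Proof. by case: n => // n _; apply: bary_simple. Qed.

Lemma hitting_bary_iter n (G : graph) : simple_graph G ->
  exists2 S : {set vert (bary_iter n G)}, #|S| <= #|vert G| & hitting S.
Proof.
move=> sG; elim: n => [|n [S cS hS]].
  exists [set: vert G]; first by rewrite cardsT.
  by move=> x; exists x; rewrite ?finset.in_setT ?connect0.
have [S' cS' hS'] := hitting_bary (bary_iter_simple n sG) hS.
by exists S' => //; apply: leq_trans cS' cS.
Qed.

End HittingSets.

(** * Regularization of the logarithm of the ratio *)

Section LogRatio.
Local Open Scope ring_scope.
Variable R : realType.

Definition log_ratio (G : graph) : R := ln (complex.Re (tree_forest_ratio R G)).

Definition logdet (c : R) (G : graph) : R := ln (\det (1%:M + c *: full_laplacian R G)).

(* [ln det (1 + K) - ln det (eps + K)], written so that each [logdet] term is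
   nearly additive over facets *)
Definition reg_log_ratio (eps : R) (G : graph) : R :=
  logdet 1 G - logdet eps^-1 G - #|vert G|%:R * ln eps.

Lemma reg_log_ratioE eps (G : graph) : 0 < eps -> 0 < \det (eps%:M + full_laplacian R G) ->
  reg_log_ratio eps G =
  ln (\det (1%:M + full_laplacian R G)) - ln (\det (eps%:M + full_laplacian R G)).
Proof.
move=> e0 d0; rewrite /reg_log_ratio /logdet scale1r.
have E : eps%:M + full_laplacian R G = eps *: (1%:M + eps^-1 *: full_laplacian R G).
  by rewrite scalerDr scalerA mulfV ?gt_eqF // scale1r scale_scalar_mx mulr1.
have dE : \det (eps%:M + full_laplacian R G) =
    eps ^+ #|vert G| * \det (1%:M + eps^-1 *: full_laplacian R G) by rewrite E detZ.
have e1 : 0 < eps ^+ #|vert G| by rewrite exprn_gt0.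
have d1 : 0 < \det (1%:M + eps^-1 *: full_laplacian R G).
  by move: d0; rewrite dE pmulr_rgt0.
by rewrite dE lnM ?posrE // lnXn // mulr_natl opprD addrA addrAC.
Qed.

(** A zero contributes exactly [ln eps]. A nonzero [l] contributes the excess [ln (1 + eps / l)], at
    most [eps / l] and so at most [M * eps]. *)
Lemma ln_prod_shift (s : seq R) (M eps : R) : 0 < eps -> 0 <= M ->
  (forall l, l \in s -> l = 0 \/ (0 < l /\ 1 <= M * l)) ->
  [/\ 0 < \prod_(l <- s | l != 0) l, 0 < \prod_(l <- s) (eps + l),
    (count_mem 0 s)%:R * ln eps + ln (\prod_(l <- s | l != 0) l)
      <= ln (\prod_(l <- s) (eps + l)) &
    ln (\prod_(l <- s) (eps + l)) <=
    (count_mem 0 s)%:R * ln eps + ln (\prod_(l <- s | l != 0) l) + (size s)%:R * M * eps].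
Proof.
move=> e0 M0; elim: s => [|l s IHs] Hs.
  by rewrite !big_nil /= ln1 !mul0r !addr0; split=> //; rewrite ltr01.
have [|A0 B0 lo hi] := IHs _; first by move=> k ks; apply: Hs; rewrite in_cons ks orbT.
rewrite !big_cons /= -natr1.
have [l0|[lgt0 Ml]] := Hs l (mem_head _ _).
  rewrite l0 eqxx /= addr0 add1n -[(count_mem 0 s).+1%:R]natr1.
  split=> //; first by rewrite mulr_gt0.
    by rewrite lnM ?posrE //; move: lo; lra.
  rewrite lnM ?posrE //.
  have : 0 <= M * eps by rewrite mulr_ge0 // ltW.
  by move: hi; rewrite !mulrDl; lra.
rewrite gt_eqF //= add0n.
have el : 0 < eps / l by rewrite divr_gt0.
have E : eps + l = l * (1 + eps / l) by rewrite mulrDr mulr1 mulrCA mulfV ?gt_eqF // mulr1 addrC.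
have lnE : ln (eps + l) = ln l + ln (1 + eps / l).
  by rewrite E lnM ?posrE // ltr_wpDr // ltW.
have ge : 0 <= ln (1 + eps / l) by rewrite ln_ge0 // lerDl ltW.
have le : ln (1 + eps / l) <= M * eps.
  apply: le_trans (le_ln1Dx _) _; first by rewrite (lt_trans _ el) // ltrN10.
  rewrite ler_pdivrMr // mulrAC; rewrite -[X in X <= _]mul1r; apply: ler_wpM2r => //.
  exact: ltW.
have el0 : 0 < eps + l by rewrite addr_gt0.
split; [by rewrite mulr_gt0|by rewrite mulr_gt0| |].
  rewrite !lnM ?posrE // lnE; move: lo; lra.
by rewrite !lnM ?posrE // lnE !mulrDl; move: hi; lra.
Qed.

(** The exponent [4] is [3] from the spectral gap plus [1] from the number of eigenvalues. Each zero
    eigenvalue costs [- ln eps]. *)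
Lemma log_ratio_approx (G : graph) (S : {set vert G}) eps :
  simple_graph G -> hitting S -> 0 < eps -> eps <= 1 ->
  `|log_ratio G - reg_log_ratio eps G| <=
    #|vert G|%:R ^+ 4 * eps - #|S|%:R * ln eps.
Proof.
move=> sG hS e0 e1; have [lam [slam Hlam detE clam ratioE]] := kirchhoff_spectrum R sG hS.
have N0 : 0 <= #|vert G|%:R ^+ 3 :> R by rewrite exprn_ge0.
have [A0 B0 lo hi] := ln_prod_shift e0 N0 Hlam.
(* The value [eps = 1] gives the positivity of the numerator [\prod (1 + l)]. *)
have [_ C0 _ _] := ln_prod_shift ltr01 N0 Hlam.
rewrite reg_log_ratioE ?detE // /log_ratio ratioE ln_div ?posrE //.
have lne : ln eps <= 0 by apply: ln_le0.
have : #|S|%:R * ln eps <= (count_mem 0 lam)%:R * ln eps.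
  by rewrite ler_wnM2r // ler_nat.
have : 0 <= - (#|S|%:R * ln eps) by rewrite -mulrN mulr_ge0 // oppr_ge0.
have c0 : (count_mem 0 lam)%:R * ln eps <= 0 by rewrite mulr_ge0_le0.
have N4 : 0 <= #|vert G|%:R ^+ 4 * eps by rewrite mulr_ge0 ?exprn_ge0 // ltW.
move: lo hi; rewrite slam -exprS => lo hi h1 h2.
by rewrite ler_norml; apply/andP; split; lra.
Qed.

Lemma log_ratio_edgeless (G : graph) : (forall x y : vert G, ~~ adj x y) -> log_ratio G = 0.
Proof.
move=> noadj.
have sG : simple_graph G by split=> [x y|x]; rewrite !(negbTE (noadj _ _)).
have hS : hitting [set: vert G] by move=> x; exists x; rewrite ?finset.in_setT ?connect0.
have [lam [slam Hlam detE clam ratioE]] := kirchhoff_spectrum R sG hS.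
have L0 : full_laplacian R G = 0.
  rewrite /full_laplacian /laplacian big_pred0 ?scaler0 // => p.
  exact/negbTE/noadj.
have p1 : \prod_(l <- lam) (1 + l) = 1 by rewrite -detE L0 addr0 det1.
(* All factors [1 + l] are at least [1] and their product is [1]. *)
have z l : l \in lam -> l = 0.
  move=> ll; have [//|[l0 _]] := Hlam l ll.
  suff : 1 < \prod_(l <- lam) (1 + l) by rewrite p1 ltxx.
  rewrite (big_rem l) //=.
  have ge1 : 1 <= \prod_(y <- rem l lam) (1 + y).
    rewrite big_seq; elim/big_ind: _ => //.
      by move=> x y x1 y1; rewrite -[1]mul1r ler_pM.
    move=> y /mem_rem/Hlam [->|[y0 _]]; first by rewrite addr0.
    by rewrite lerDl ltW.
  by apply: lt_le_trans (_ : 1 < 1 + l) _; [rewrite ltrDl | rewrite ler_peMr // addr_ge0 // ltW].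
rewrite /log_ratio ratioE p1 big_seq_cond big1 ?divr1 ?ln1 //.
by move=> l /andP[/z ->]; rewrite eqxx.
Qed.

End LogRatio.

(** * Comparison with the simplex *)

Section FacetMeeting.

Lemma facets_meet d (G : graph) : clique_le d.+1 G ->
  @meets_facets d (bary G) (fun s => [exists A : facet d G, facet_int A s]).
Proof.
move=> dG F cF eF.
have F0 : F != finset.set0 by rewrite -card_gt0 eF.
have /imsetP[s sF es] := top_in_vals cF F0.
have et : #|val s| = d.+1.
  apply/eqP; rewrite eqn_leq dG ?bary_vert_clique //= -eF -es.
  exact: card_top_ge.
have H : is_clique (val s) && (#|val s| == d.+1) by rewrite bary_vert_clique et eqxx.
by apply/exists_inP; exists s => //; apply/existsP; exists (Sub (val s) H); rewrite /facet_int SubK.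
Qed.

Lemma simplex_meet d : meets_facets d (@simplex_int d).
Proof.
move=> F cF eF.
have F0 : F != finset.set0 by rewrite -card_gt0 eF.
have /imsetP[s sF es] := top_in_vals cF F0.
apply/exists_inP; exists s => //; rewrite /simplex_int eqEcard finset.subsetT cardsT card_ord.
by rewrite -eF -es card_top_ge.
Qed.

End FacetMeeting.

Section Comparison.
Local Open Scope ring_scope.
Variable R : realType.

(** The index is shifted: this is the refinement of order [n + 1]. *)
Definition simplex_bary d n : graph := bary_iter n (bary (complete d)).

Lemma dist_sandwich (x y p u v : R) : 0 <= u -> 0 <= v ->
  p <= x -> x <= p + u -> p <= y -> y <= p + v -> `|x - y| <= u + v.
Proof. by move=> *; rewrite ler_norml; apply/andP; split; lra. Qed.

Lemma bad_weight_iter_real n d (G : graph) (int : pred (vert G)) (W := (2 * 2 ^ 2 ^ d.+1)%N) :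
  (0 < d)%N -> clique_le d.+1 G -> meets_facets d int ->
  (bad_weight W (up_iter n int))%:R <=
    (bad_weight W int)%:R * ((d * d`!)%:R + 2^-1) ^+ n :> R.
Proof.
move=> d0 dG mG; have H := bad_weight_iter n d0 dG mG.
rewrite -(ler_nat R) !natrM !natrX natrD natrM in H.
have -> : ((d * d`!)%:R + 2^-1 : R) = (2 * (d * d`!)%:R + 1) / 2 by field.
rewrite expr_div_n mulrA ler_pdivlMr ?exprn_gt0 // mulrC.
by rewrite [X in _ <= X]mulrC.
Qed.

(** The constant [c] depends neither on [n] nor on [t], which allows [t] to be [eps^-1] with [eps]
    varying with [n]. *)
Lemma simplex_facet_comparison d (G : graph) (f := num_cliques G d.+1) :
  (0 < d)%N -> simple_graph G -> clique_le d.+1 G ->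
  exists2 c : R, 0 <= c & forall n (B := c * ((d * d`!)%:R + 2^-1) ^+ n),
    `|#|vert (bary_iter n (bary G))|%:R - f%:R * #|vert (simplex_bary d n)|%:R| <= B /\
    forall t, 0 <= t ->
      `|logdet t (bary_iter n (bary G)) - f%:R * logdet t (simplex_bary d n)|
        <= B * ln (1 + t).
Proof.
move=> d0 sG dG; set W := (2 * 2 ^ 2 ^ d.+1)%N; set rho : R := (d * d`!)%:R + 2^-1.
have W0 : (0 < W)%N by rewrite muln_gt0 expn_gt0.
pose intG (A : facet d G) := facet_int A.
pose anyG s := [exists A, intG A s].
pose bG := bad_weight W anyG; pose bD := bad_weight W (@simplex_int d).
pose c : R := (d.+1 ^ 2)%:R * (bG%:R + f%:R * bD%:R).
have c0 : 0 <= c by rewrite mulr_ge0 // addr_ge0 // mulr_ge0.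
exists c => // n B.
have dbG := clique_le_bary dG; have dD := @complete_clique_le d.
have dbD := clique_le_bary dD.
have sGn : simple_graph (bary_iter n (bary G)) by apply/bary_iter_simple/bary_simple.
have sDn : simple_graph (simplex_bary d n) by apply/bary_iter_simple/bary_simple.
have wG := bad_weight_iter_real n d0 dbG (facets_meet dG).
have wD := bad_weight_iter_real n d0 dbD (@simplex_meet d).
rewrite -/rho -/W in wG wD.
pose iG (A : facet d G) := up_iter n (intG A).
have sep : separated iG by apply/separated_iter/facet_separated.
have emb A : exists phi, facet_embedding (iG A) (up_iter n (@simplex_int d)) phi.
  exact/facet_embedding_iter/facet_start.
pose aG x := [exists A, iG A x].
have aGE : up_iter n anyG =1 aG by move=> x; apply: up_iter_exists.
have cardI : #|{: facet d G}| = f := card_facet d G.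
have wG' : (bad_weight W aG)%:R <= bG%:R * rho ^+ n.
  apply: le_trans wG; rewrite le_eqVlt; apply/orP; left; apply/eqP; congr (_%:R).
  apply: eq_bigl => A; rewrite /bad_clique; congr (_ && _).
  by apply: eq_existsb => x; rewrite aGE.
have rho0 : 0 <= rho by rewrite addr_ge0 // invr_ge0.
have rn0 : 0 <= rho ^+ n by rewrite exprn_ge0.
have D1 : 1 <= (d.+1 ^ 2)%:R :> R by rewrite ler1n expn_gt0.
split.
  have vG : #|vert (bary_iter n (bary G))|%:R =
      f%:R * #|[set x | up_iter n (@simplex_int d) x]|%:R + #|[set x | ~~ aG x]|%:R :> R.
    rewrite -natrM -cardI -(card_int_facets sep emb) -natrD -(cardsC [set x | aG x]).
    congr (_ + _)%:R; apply: eq_card => x; by rewrite !inE.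
  have vD : #|vert (simplex_bary d n)|%:R =
      #|[set x | up_iter n (@simplex_int d) x]|%:R + #|[set x | ~~ up_iter n (@simplex_int d) x]|%:R :> R.
    rewrite -natrD -(cardsC [set x | up_iter n (@simplex_int d) x]).
    congr (_ + _)%:R; apply: eq_card => x; by rewrite !inE.
  have bvG : #|[set x | ~~ aG x]|%:R <= bG%:R * rho ^+ n.
    by apply: le_trans wG'; rewrite ler_nat bad_vertices_le.
  have bvD : #|[set x | ~~ up_iter n (@simplex_int d) x]|%:R <= bD%:R * rho ^+ n.
    by apply: le_trans wD; rewrite ler_nat bad_vertices_le.
  have bvD' : f%:R * #|[set x | ~~ up_iter n (@simplex_int d) x]|%:R <= f%:R * (bD%:R * rho ^+ n).
    by rewrite ler_wpM2l.
  have E : #|vert (bary_iter n (bary G))|%:R - f%:R * #|vert (simplex_bary d n)|%:R =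
    #|[set x | ~~ aG x]|%:R - f%:R * #|[set x | ~~ up_iter n (@simplex_int d) x]|%:R :> R.
    by rewrite vG vD; ring.
  rewrite E; have h1 : 0 <= #|[set x | ~~ aG x]|%:R :> R by [].
  have h2 : 0 <= f%:R * #|[set x | ~~ up_iter n (@simplex_int d) x]|%:R :> R by rewrite mulr_ge0.
  have h3 : (bG%:R + f%:R * bD%:R) * rho ^+ n <= B.
    by rewrite /B -mulrA ler_peMl // mulr_ge0 // addr_ge0 // mulr_ge0.
  rewrite mulrDl -mulrA in h3.
  by rewrite ler_norml; apply/andP; split; lra.
move=> t t0.
have [X0 /andP[lG hG]] := det_full_laplacian_inner aG t0.
have [Y0 /andP[lD hD]] := det_full_laplacian_inner (up_iter n (@simplex_int d)) t0.
move: X0 lG hG; rewrite (det_facets sep emb) cardI => X0 lG hG.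
set Y := \det _ in Y0 lD hD X0 lG hG.
have t1 : 0 < 1 + t by rewrite ltr_pwDl.
have dG0 := lt_le_trans X0 lG; have dD0 := lt_le_trans Y0 lD.
have lnt : 0 <= ln (1 + t) by rewrite ln_ge0 // lerDl.
have LG : f%:R * ln Y <= logdet t (bary_iter n (bary G)).
  by rewrite /logdet mulr_natl -lnXn // ler_ln // posrE.
have LD : ln Y <= logdet t (simplex_bary d n) by rewrite /logdet ler_ln // posrE.
have HG : logdet t (bary_iter n (bary G)) <= f%:R * ln Y + #|bad_edges aG|%:R * ln (1 + t).
  rewrite /logdet !mulr_natl -!lnXn // -lnM ?posrE ?exprn_gt0 // ler_ln ?posrE //.
  by rewrite mulr_gt0 ?exprn_gt0.
have HD : logdet t (simplex_bary d n) <=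
    ln Y + #|bad_edges (up_iter n (@simplex_int d))|%:R * ln (1 + t).
  rewrite /logdet !mulr_natl -!lnXn // -lnM ?posrE ?exprn_gt0 // ler_ln ?posrE //.
  by rewrite mulr_gt0 ?exprn_gt0.
have eG : #|bad_edges aG|%:R <= (d.+1 ^ 2)%:R * (bG%:R * rho ^+ n).
  apply: le_trans (ler_wpM2l _ wG') => //; rewrite -natrM ler_nat.
  exact/bad_edges_le/clique_le_bary_iter.
have eD : #|bad_edges (up_iter n (@simplex_int d))|%:R <= (d.+1 ^ 2)%:R * (bD%:R * rho ^+ n).
  apply: le_trans (ler_wpM2l _ wD) => //; rewrite -natrM ler_nat.
  exact/bad_edges_le/clique_le_bary_iter.
have f0 : 0 <= f%:R :> R by [].
have eG' := ler_wpM2r lnt eG; have eD' := ler_wpM2l f0 (ler_wpM2r lnt eD).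
have -> : B * ln (1 + t) = (d.+1 ^ 2)%:R * (bG%:R * rho ^+ n) * ln (1 + t)
  + f%:R * ((d.+1 ^ 2)%:R * (bD%:R * rho ^+ n) * ln (1 + t)).
  by rewrite /B /c; ring.
have g0 : 0 <= (d.+1 ^ 2)%:R * (bG%:R * rho ^+ n) * ln (1 + t) by rewrite !mulr_ge0.
have g1 : 0 <= f%:R * ((d.+1 ^ 2)%:R * (bD%:R * rho ^+ n) * ln (1 + t)) by rewrite !mulr_ge0.
apply: (dist_sandwich g0 g1 LG).
- by apply: le_trans HG _; rewrite lerD2l.
- exact: ler_wpM2l.
- by apply: le_trans (ler_wpM2l f0 HD) _; rewrite mulrDr lerD2l.
Qed.

End Comparison.

(** * Error terms in the comparison of the ratios *)

Section Universality.
Local Open Scope ring_scope.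
Variable R : realType.

Lemma ln_iter_exp (x : R) n k : 0 < x -> ln ((x ^+ n) ^+ k) = k%:R * n%:R * ln x.
Proof.
move=> x0; rewrite !lnXn ?exprn_gt0 // -mulrnA -[LHS]mulr_natl natrM.
by rewrite [n%:R * _]mulrC.
Qed.

(** There are at most [M ^ n * v] vertices, so this [eps] keeps the fourth-power error below
    [v ^ 4]. The other error is linear in [n], since the initial [v] vertices bound the multiplicity
    of [0]. *)
Lemma log_ratio_iter_approx d n (G : graph) (M : R := (2 ^ 2 ^ d.+1)%:R)
    (v : R := #|vert (bary G)|%:R) (eps : R := (M ^+ n) ^- 4) :
  simple_graph G -> clique_le d.+1 G ->
  `|log_ratio R (bary_iter n (bary G)) - reg_log_ratio eps (bary_iter n (bary G))|
    <= v ^+ 4 + v * (4 * n%:R * ln M).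
Proof.
move=> sG dG; set H := bary_iter n (bary G).
have sH : simple_graph H by apply/bary_iter_simple/bary_simple.
have M1 : 1 <= M by rewrite ler1n expn_gt0.
have cardH : #|vert H|%:R <= M ^+ n * v.
  by rewrite -natrX -natrM ler_nat; apply: card_bary_iter.
clearbody M; have M0 : 0 < M := lt_le_trans ltr01 M1.
have Mn1 : 1 <= M ^+ n by rewrite exprn_ege1.
have Mn0 : 0 < M ^+ n by rewrite exprn_gt0.
have Mn4 : 0 < (M ^+ n) ^+ 4 by rewrite exprn_gt0.
have e0 : 0 < eps by rewrite invr_gt0.
have e1 : eps <= 1 by rewrite invf_le1 // exprn_ege1.
have [S cS hS] := hitting_bary_iter n (bary_simple G).
apply: le_trans (log_ratio_approx sH hS e0 e1) _.
have lnE : ln eps = - (4 * n%:R * ln M).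
  by rewrite lnV ?posrE // ln_iter_exp.
rewrite lnE mulrN opprK lerD //.
  have hv : 0 <= v * M ^+ n by rewrite mulr_ge0 // ltW.
  by rewrite ler_pdivrMr // -exprMn ler_pXn2r ?nnegrE // [v * _]mulrC.
by rewrite ler_wpM2r ?ler_nat // !mulr_ge0 // ln_ge0.
Qed.

Lemma log_ratio_facet_comparison d (G : graph) (f := num_cliques G d.+1) :
  (0 < d)%N -> simple_graph G -> clique_le d.+1 G ->
  exists2 c : R, 0 <= c & forall n,
    `|log_ratio R (bary_iter n (bary G)) - f%:R * log_ratio R (simplex_bary d n)|
      <= c * n.+1%:R * ((d * d`!)%:R + 2^-1) ^+ n.
Proof.
move=> d0 sG dG; have [c0 c0_ge0 H0] := simplex_facet_comparison R d0 sG dG.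
set rho : R := (d * d`!)%:R + 2^-1 in H0 *.
pose M : R := (2 ^ 2 ^ d.+1)%:R.
pose vG : R := #|vert (bary G)|%:R; pose vD : R := #|vert (bary (complete d))|%:R.
pose a := vG ^+ 4 + f%:R * vD ^+ 4.
pose b := (vG + f%:R * vD) * (4 * ln M).
pose e := c0 * (2 * ln 2); pose g := c0 * (8 * ln M).
have M1 : 1 <= M by rewrite ler1n expn_gt0.
have HG n : `|log_ratio R (bary_iter n (bary G)) - reg_log_ratio ((M ^+ n) ^- 4) (bary_iter n (bary G))|
    <= vG ^+ 4 + vG * (4 * n%:R * ln M) := log_ratio_iter_approx n sG dG.
have HD n : `|log_ratio R (simplex_bary d n) - reg_log_ratio ((M ^+ n) ^- 4) (simplex_bary d n)|
    <= vD ^+ 4 + vD * (4 * n%:R * ln M) :=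
  log_ratio_iter_approx n (complete_simple d) (@complete_clique_le d).
clearbody M; have M0 : 0 < M := lt_le_trans ltr01 M1.
have lnM0 : 0 <= ln M by rewrite ln_ge0.
have ln2 : 0 <= ln 2 :> R by rewrite ln_ge0 // ler1n.
have f0 : 0 <= f%:R :> R by [].
have a0 : 0 <= a by rewrite /a addr_ge0 ?mulr_ge0 ?exprn_ge0.
have b0 : 0 <= b by rewrite /b mulr_ge0 ?addr_ge0 ?mulr_ge0.
have e_ge0 : 0 <= e by rewrite /e mulr_ge0 // mulr_ge0 // ler0n.
have g0 : 0 <= g by rewrite /g mulr_ge0 // mulr_ge0 // ler0n.
exists (a + b + e + g); first exact: addr_ge0 (addr_ge0 (addr_ge0 a0 b0) e_ge0) g0.
move=> n; have [HV HQ] := H0 n; set B := c0 * rho ^+ n in HV HQ.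
pose eps : R := (M ^+ n) ^- 4.
have Mn4 : 1 <= (M ^+ n) ^+ 4 by rewrite !exprn_ege1.
have Mn40 : 0 < (M ^+ n) ^+ 4 := lt_le_trans ltr01 Mn4.
have lnE : ln eps = - (4 * n%:R * ln M).
  by rewrite lnV ?posrE // ln_iter_exp.
move: (HG n) (HD n) => {}HG {}HD; rewrite -/eps in HG HD.
have Q1 := HQ 1 ler01.
have epsV : eps^-1 = (M ^+ n) ^+ 4 by rewrite invrK.
have eV0 : 0 <= eps^-1 by rewrite epsV ltW.
have Qe := HQ eps^-1 eV0.
have rho1 : 1 <= rho.
  apply: (@le_trans _ _ (d * d`!)%:R); last by rewrite lerDl invr_ge0.
  by rewrite ler1n muln_gt0 d0 fact_gt0.
have rn1 : 1 <= rho ^+ n by rewrite exprn_ege1.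
have B0 : 0 <= B by rewrite mulr_ge0 // (le_trans ler01).
(* As [eps^-1] is at least [1], [1 + eps^-1] is at most [2 * eps^-1]. *)
have lnle : ln (1 + eps^-1) <= ln 2 + 4 * n%:R * ln M.
  rewrite epsV -ln_iter_exp // -lnM ?posrE ?ltr0n //.
  set E := (M ^+ n) ^+ 4 in Mn4 Mn40 *.
  by rewrite ler_ln ?posrE; lra.
set TG := log_ratio R _ in HG *; set TD := log_ratio R _ in HD *.
set PG := reg_log_ratio _ _ in HG; set PD := reg_log_ratio _ _ in HD.
(* The same [eps] serves both graphs; the three terms come from [logdet] at [1], [logdet] at
   [eps^-1] and the vertex counts. *)
have HP : `|PG - f%:R * PD| <= B * ln 2 + B * (ln 2 + 4 * n%:R * ln M) + B * (4 * n%:R * ln M).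
  have -> : PG - f%:R * PD =
    (logdet 1 (bary_iter n (bary G)) - f%:R * logdet 1 (simplex_bary d n))
    - (logdet eps^-1 (bary_iter n (bary G)) - f%:R * logdet eps^-1 (simplex_bary d n))
    - (#|vert (bary_iter n (bary G))|%:R - f%:R * #|vert (simplex_bary d n)|%:R) * ln eps.
    by rewrite /PG /PD /reg_log_ratio; ring.
  apply: le_trans (ler_normB _ _) _; apply: lerD.
    apply: le_trans (ler_normB _ _) _; apply: lerD; first exact: Q1.
    by apply: le_trans Qe _; rewrite ler_wpM2l.
  rewrite normrM lnE normrN [`|4 * _ * _|]ger0_norm; last by rewrite !mulr_ge0.
  by rewrite ler_wpM2r // !mulr_ge0.
have HD' : `|f%:R * (PD - TD)| <= f%:R * (vD ^+ 4 + vD * (4 * n%:R * ln M)).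
  by rewrite normrM ger0_norm // distrC ler_wpM2l.
have -> : TG - f%:R * TD = (TG - PG) + (PG - f%:R * PD) + f%:R * (PD - TD) by ring.
apply: le_trans (ler_normD _ _) _.
apply: le_trans (lerD (ler_normD _ _) HD') _.
apply: le_trans (lerD (lerD HG HP) (lexx _)) _.
have -> : vG ^+ 4 + vG * (4 * n%:R * ln M) +
  (B * ln 2 + B * (ln 2 + 4 * n%:R * ln M) + B * (4 * n%:R * ln M)) +
  f%:R * (vD ^+ 4 + vD * (4 * n%:R * ln M)) = a + b * n%:R + (e + g * n%:R) * rho ^+ n.
  by rewrite /a /b /e /g /B; ring.
have n0 : 0 <= n%:R :> R by [].
have h1 : a + b * n%:R <= (a + b * n%:R) * rho ^+ n.
  by rewrite ler_peMr // addr_ge0 // mulr_ge0.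
apply: le_trans (lerD h1 (lexx _)) _; rewrite -mulrDl; apply: ler_wpM2r.
  by rewrite (le_trans ler01).
rewrite -natr1.
have -> : (a + b + e + g) * (n%:R + 1)
  = a + b * n%:R + (e + g * n%:R) + (a * n%:R + b + e * n%:R + g) by ring.
rewrite lerDl; apply: addr_ge0 g0; apply: addr_ge0 (mulr_ge0 e_ge0 n0).
exact: addr_ge0 (mulr_ge0 a0 n0) b0.
Qed.

End Universality.

(** * Sequences of almost geometric growth *)

Section Limits.
Local Open Scope classical_set_scope.
Local Open Scope ring_scope.
Variable R : realType.

Lemma bernoulli_le (h : R) n : 0 <= h -> 1 + n%:R * h <= (1 + h) ^+ n.
Proof.
move=> h0; elim: n => [|n IHn]; first by rewrite mul0r addr0 expr0.
rewrite exprS -natr1; apply: le_trans (ler_wpM2l _ IHn); last by rewrite addr_ge0.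
have : 0 <= n%:R * h * h by rewrite !mulr_ge0.
by move: (n%:R : R) => k; lra.
Qed.

(** For [q] halfway between [x] and [1], Bernoulli's inequality for [q / x = 1 + h] absorbs the
    factor [n + 1]. *)
Lemma linear_geometric_le (x : R) : 0 < x -> x < 1 ->
  exists q c : R, [/\ 0 < q, q < 1, 0 <= c & forall n, n.+1%:R * x ^+ n <= c * q ^+ n].
Proof.
move=> x0 x1; pose q := (1 + x) / 2; pose h := q / x - 1.
have q0 : 0 < q by rewrite /q; lra.
have qx : x < q by rewrite /q; lra.
have h0 : 0 < h by rewrite subr_gt0 ltr_pdivlMr // mul1r.
exists q, (1 + h^-1); split=> //; first by rewrite /q; lra.
  by rewrite addr_ge0 // invr_ge0 ltW.
move=> n.
have Eq : q = x * (1 + h) by rewrite /h addrC subrK mulrCA mulfV ?mulr1 // gt_eqF.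
clearbody h; rewrite Eq exprMn mulrCA [X in X <= _]mulrC; apply: ler_wpM2l; first by rewrite exprn_ge0 // ltW.
apply: (@le_trans _ _ ((1 + h^-1) * (1 + n%:R * h))); last first.
  apply: ler_wpM2l; first by rewrite addr_ge0 // invr_ge0 ltW.
  by apply: bernoulli_le; rewrite ltW.
have -> : (1 + h^-1) * (1 + n%:R * h) = n.+1%:R + (h^-1 + n%:R * h).
  by rewrite -natr1; field; rewrite gt_eqF.
by rewrite lerDl addr_ge0 ?mulr_ge0 ?invr_ge0 // ltW.
Qed.


Lemma cvg_normr_le_geometric (u : R^nat) (c q : R) : 0 < q -> q < 1 ->
  (forall n, `|u n| <= c * q ^+ n) -> u @ \oo --> (0 : R).
Proof.
move=> q0 q1 Hu; apply: norm_cvg0; apply: (@squeeze_cvgr _ _ _ _ (fun=> 0) (geometric c q)).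
- by near=> n; rewrite normr_ge0 /geometric /= Hu.
- exact: cvg_cst.
- by apply: cvg_geometric; rewrite gtr0_norm.
Unshelve. all: by end_near. Qed.

Lemma cvg_linear_geometric (u : R^nat) (c r m : R) : 0 < r -> r < m ->
  (forall n, `|u n| <= c * n.+1%:R * r ^+ n) -> (fun n => u n / m ^+ n) @ \oo --> (0 : R).
Proof.
move=> r0 rm Hu; have m0 := lt_trans r0 rm.
have x0 : 0 < r / m by rewrite divr_gt0.
have x1 : r / m < 1 by rewrite ltr_pdivrMr // mul1r.
have [q [c' [q0 q1 c'0 Hq]]] := linear_geometric_le x0 x1.
have c0 : 0 <= c by have := Hu 0%N; rewrite expr0 !mulr1; apply: le_trans.
apply: (@cvg_normr_le_geometric _ (c * c') q) => // n.
have mV k : 0 <= (m ^+ k)^-1 by rewrite invr_ge0 exprn_ge0 // ltW.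
rewrite normrM [`|_^-1|]ger0_norm //.
apply: (@le_trans _ _ (c * (n.+1%:R * (r / m) ^+ n))).
  by rewrite expr_div_n !mulrA; apply: ler_wpM2r.
by rewrite -mulrA ler_wpM2l.
Qed.

(** The increments of [u n / m ^ n] are dominated by a convergent geometric series. *)
Lemma cvg_almost_geometric (u : R^nat) (c r m : R) : 0 < r -> r < m ->
  (forall n, `|u n.+1 - m * u n| <= c * n.+1%:R * r ^+ n) ->
  exists a : R, (fun n => u n / m ^+ n) @ \oo --> a.
Proof.
move=> r0 rm Hu; have m0 := lt_trans r0 rm.
have x0 : 0 < r / m by rewrite divr_gt0.
have x1 : r / m < 1 by rewrite ltr_pdivrMr // mul1r.
have [q [c' [q0 q1 c'0 Hq]]] := linear_geometric_le x0 x1.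
have c0 : 0 <= c by have := Hu 0%N; rewrite expr0 !mulr1; apply: le_trans.
pose a : R^nat := fun n => u n / m ^+ n.
have Ha n : `|a n.+1 - a n| <= geometric (c * c' / m) q n.
  have -> : a n.+1 - a n = (u n.+1 - m * u n) / m ^+ n.+1.
    by rewrite /a exprS; field; rewrite expf_neq0 ?gt_eqF.
  have mV k : 0 <= (m ^+ k)^-1 by rewrite invr_ge0 exprn_ge0 // ltW.
  rewrite normrM [`|_^-1|]ger0_norm // /geometric /=.
  apply: (@le_trans _ _ (c / m * (n.+1%:R * (r / m) ^+ n))).
    rewrite (_ : c / m * (n.+1%:R * (r / m) ^+ n) = c * n.+1%:R * r ^+ n / m ^+ n.+1).
      exact: ler_wpM2r.
    by rewrite expr_div_n exprS; field; rewrite expf_neq0 ?gt_eqF.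
  rewrite (_ : c * c' / m * q ^+ n = c / m * (c' * q ^+ n)); last by ring.
  by apply: ler_wpM2l => //; rewrite divr_ge0 // ltW.
have cs : cvgn (series (telescope a)).
  apply: normed_cvg; apply: (@series_le_cvg _ _ (geometric (c * c' / m) q)) => [n|n|n|].
  - exact: normr_ge0.
  - by apply: le_trans (Ha n); apply: normr_ge0.
  - exact: Ha.
  - by apply: is_cvg_geometric_series; rewrite gtr0_norm.
exists (a 0%N + limn (series (telescope a))).
rewrite (_ : (fun n => u n / m ^+ n) = (fun n => a 0%N + series (telescope a) n)).
  by apply: cvgD => //; apply: cvg_cst.
by apply/funext => n; rewrite -eq_sum_telescope.
Qed.

End Limits.

(** A vertex is a clique, so the maximum is positive and the predecessor in [gdim] can be undone. *)
Lemma max_clique_sizeP (G : graph) : (0 < #|vert G|)%N ->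
  clique_le (gdim G).+1 G /\ (0 < num_cliques G (gdim G).+1)%N.
Proof.
move=> /card_gt0P[x _].
have le (A : {set vert G}) : is_clique A -> (#|A| <= max_clique_size G)%N.
  by move=> cA; rewrite /max_clique_size (bigD1 A) //= leq_maxl.
have cx : is_clique [set x].
  by apply/is_cliqueP => u v; rewrite !inE => /eqP-> /eqP->; rewrite eqxx.
have m0 : (0 < max_clique_size G)%N by rewrite (leq_trans _ (le _ cx)) // cards1.
rewrite /gdim prednK //; split=> //.
have [|A cA EA] := @eq_bigmax_cond _ (mem [pred A : {set vert G} | is_clique A]) (fun A : {set vert G} => #|A|).
  by apply/card_gt0P; exists [set x]; rewrite inE.
apply/card_gt0P; exists A; rewrite !inE in cA *; rewrite cA /= -EA; apply/eqP.
by apply: eq_bigl => B; rewrite inE.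
Qed.


(** * Existence of the limit and its dependence on the dimension alone *)

Section UniversalLimit.
Local Open Scope classical_set_scope.
Local Open Scope ring_scope.
Variable R : realType.

(** After division by [m ^ n], the numerator tends to [f * a] and the number of vertices to [f * b],
    where [a] and [b] belong to the simplex; [f] cancels. *)
Lemma tree_forest_index_universal d : (0 < d)%N -> exists l : R,
  forall G : graph, simple_graph G -> clique_le d.+1 G -> (0 < num_cliques G d.+1)%N ->
    (fun n => tree_forest_index R (bary_iter n G)) @ \oo --> l.
Proof.
move=> d0; pose m : R := (d.+1)`!%:R; pose r : R := (d * d`!)%:R + 2^-1.
have r0 : 0 < r by rewrite ltr_wpDl // invr_gt0.
have rm : r < m.
  rewrite /r /m factS mulSn addnC natrD ltrD2l.
  apply: (@lt_le_trans _ _ 1); first by rewrite invf_lt1 // ltr1n.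
  by rewrite ler1n fact_gt0.
have m0 := lt_trans r0 rm.
pose T n := log_ratio R (simplex_bary d n).
pose V n : R := #|vert (simplex_bary d n)|%:R.
have sK := complete_simple d; have dK := @complete_clique_le d.
have fK : num_cliques (bary (complete d)) d.+1 = (d.+1)`!.
  by rewrite num_cliques_bary // complete_num_cliques muln1.
have mE : m = (num_cliques (bary (complete d)) d.+1)%:R by rewrite fK.
have shift n : bary_iter n (bary (bary (complete d))) = simplex_bary d n.+1.
  by rewrite /simplex_bary bary_iter_bary.
have [c1 c1_ge0 H1] := log_ratio_facet_comparison R d0 (bary_simple _) (clique_le_bary dK).
have [c2 c2_ge0 H2] := simplex_facet_comparison R d0 (bary_simple _) (clique_le_bary dK).
have [a Ha] : exists a : R, (fun n => T n / m ^+ n) @ \oo --> a.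
  by apply: (cvg_almost_geometric r0 rm) => n; rewrite /T -shift mE; apply: H1.
have rn_ge0 n : 0 <= r ^+ n by rewrite exprn_ge0 // ltW.
have weaken c n : 0 <= c -> c * r ^+ n <= c * n.+1%:R * r ^+ n.
  by move=> c0; rewrite ler_wpM2r // ler_peMr // ler1n.
have [b Hb] : exists b : R, (fun n => V n / m ^+ n) @ \oo --> b.
  apply: (@cvg_almost_geometric _ _ c2 _ _ r0 rm) => n; rewrite /V -shift mE.
  by apply: le_trans (weaken _ _ c2_ge0); apply: (H2 n).1.
(* Each of the [m ^ n] facets of a refined simplex becomes a vertex of the next refinement; this
   keeps the denominator away from [0]. *)
have b1 : 1 <= b.
  rewrite -(cvg_lim _ Hb) //; apply: limr_ge; first exact: cvgP Hb.
  near=> n.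
  rewrite ler_pdivlMr ?exprn_gt0 // mul1r -natrX ler_nat /simplex_bary bary_iter_bary /=.
  apply: leq_trans (num_cliques_le_card_bary d _).
  by rewrite num_cliques_iter // complete_num_cliques muln1.
have b0 : b != 0 by rewrite gt_eqF // (lt_le_trans ltr01).
exists (a / b) => G sG dG f0.
set f := num_cliques G d.+1 in f0.
have fR0 : f%:R != 0 :> R by rewrite pnatr_eq0 -lt0n.
have [c3 c3_ge0 H3] := log_ratio_facet_comparison R d0 sG dG.
have [c4 c4_ge0 H4] := simplex_facet_comparison R d0 sG dG.
pose TG n := log_ratio R (bary_iter n (bary G)).
pose VG n : R := #|vert (bary_iter n (bary G))|%:R.
have HT : (fun n => TG n / m ^+ n) @ \oo --> f%:R * a.
  have e0 := cvg_linear_geometric r0 rm H3.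
  rewrite (_ : (fun n => _) = (fun n => (TG n - f%:R * T n) / m ^+ n + f%:R * (T n / m ^+ n))).
    rewrite -[f%:R * a]add0r; apply: cvgD; first exact: e0.
    by apply: cvgM; [exact: cvg_cst|exact: Ha].
  by apply/funext => n; rewrite mulrBl mulrA subrK.
have HV : (fun n => VG n / m ^+ n) @ \oo --> f%:R * b.
  have e0 : (fun n => (VG n - f%:R * V n) / m ^+ n) @ \oo --> (0 : R).
    apply: (@cvg_linear_geometric _ _ c4 _ _ r0 rm) => n.
    by apply: le_trans (weaken _ _ c4_ge0); apply: (H4 n).1.
  rewrite (_ : (fun n => _) = (fun n => (VG n - f%:R * V n) / m ^+ n + f%:R * (V n / m ^+ n))).
    rewrite -[f%:R * b]add0r; apply: cvgD; first exact: e0.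
    by apply: cvgM; [exact: cvg_cst|exact: Hb].
  by apply/funext => n; rewrite mulrBl mulrA subrK.
rewrite -cvg_shiftS /=.
have -> : (fun n => tree_forest_index R (bary_iter n.+1 G)) =
   (fun n => (TG n / m ^+ n) * (VG n / m ^+ n)^-1).
  apply/funext => n; rewrite /tree_forest_index -bary_iter_bary -/(log_ratio R _) -/(TG n) -/(VG n).
  rewrite invfM invrK mulrACA mulrA mulfVK ?expf_neq0 ?gt_eqF //.
have -> : a / b = (f%:R * a) * (f%:R * b)^-1.
  by field; rewrite fR0 b0.
apply: cvgM => //; apply: cvgV => //.
by rewrite mulf_neq0.
Unshelve. all: by end_near. Qed.

Lemma tree_forest_index_edgeless (G : graph) : simple_graph G -> clique_le 1 G ->
  (fun n => tree_forest_index R (bary_iter n G)) @ \oo --> (0 : R).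
Proof.
move=> sG dG.
have -> : (fun n => tree_forest_index R (bary_iter n G)) = fun=> 0.
  apply/funext => n; rewrite /tree_forest_index -/(log_ratio R _) log_ratio_edgeless ?mul0r //.
  have [symH irrH] := bary_iter_simple n sG.
  move=> x y; apply/negP => xy; have nxy : x != y by apply: contraTneq xy => ->; rewrite irrH.
  have cl : is_clique [set x; y]%SET.
    apply/is_cliqueP => u v; rewrite !inE.
    by move=> /orP[]/eqP-> /orP[]/eqP->; rewrite ?eqxx // symH.
  by have := @clique_le_bary_iter n _ _ dG _ cl; rewrite cards2 nxy.
exact: cvg_cst.
Qed.

Lemma tree_forest_index_limit d : exists l : R,
  forall G : graph, simple_graph G -> (0 < #|vert G|)%N -> gdim G = d ->
    (fun n => tree_forest_index R (bary_iter n G)) @ \oo --> l.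
Proof.
have [->|d0] := posnP d.
  exists 0 => G sG G0 dG; apply: tree_forest_index_edgeless => //.
  by have [+ _] := max_clique_sizeP G0; rewrite dG.
have [l Hl] := tree_forest_index_universal d0.
by exists l => G sG /max_clique_sizeP[le gt] dG; apply: Hl => //; rewrite -dG.
Qed.

End UniversalLimit.

(** * Subdivision of cycles *)

Definition simplex (G : graph) (s : vert (bary G)) : {set vert G} := val s.

Definition mk_simplex (G : graph) (A : {set vert G})
  (cA : is_clique A && (A != finset.set0)) : vert (bary G) := Sub A cA.
Arguments mk_simplex {G} A cA.

Lemma mk_simplexK (G : graph) (A : {set vert G}) cA : simplex (mk_simplex A cA) = A.
Proof. exact: SubK. Qed.

Lemma simplex_inj (G : graph) : injective (@simplex G).
Proof. exact: val_inj. Qed.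

Lemma bary_adjE (G : graph) (s t : vert (bary G)) :
  adj s t = (simplex s \proper simplex t) || (simplex t \proper simplex s).
Proof. by []. Qed.

Section Bipartite.
Local Open Scope ring_scope.

(** With [s = t + 2], Sylvester's identity passes to blocks of size [n] and a Schur complement
    leaves [1 - s^-2 * w^T w]. As [n' = 2 * n], the factor [s ^ n'] turns this into the determinant
    of [s ^ 2 - w^T w]. *)
Lemma det_bipartite_laplacian (R : realFieldType) n n' (p w : 'M[R]_(n', n)) t : 0 < t ->
  n' = (2 * n)%N -> p^T *m p = 1%:M -> w^T *m p = 0 ->
  \det (t%:M + (2%:M - (p *m w^T + w *m p^T))) =
  \det ((t ^+ 2 + 4 * t)%:M + (4%:M - w^T *m w)).
Proof.
move=> t0 n'E ptp wtp; pose s := t + 2; have s0 : s != 0 by rewrite gt_eqF // addr_gt0.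
have ptw : p^T *m w = 0 by rewrite -[LHS]trmxK trmx_mul trmxK wtp trmx0.
have -> : t%:M + (2%:M - (p *m w^T + w *m p^T)) =
    s *: (1%:M + (row_mx p w) *m (- s^-1 *: col_mx w^T p^T)).
  rewrite -scalemxAr mul_row_col scalerDr scalerA mulrN mulfV // scaleN1r.
  by rewrite addrA -raddfD /= scale_scalar_mx mulr1.
rewrite detZ det_one_addM -scalemxAl mul_col_row wtp ptp ptw.
set Q := w^T *m w.
have -> : 1%:M + - s^-1 *: block_mx 0 Q 1%:M 0 =
  block_mx 1%:M (- s^-1 *: Q) (- s^-1)%:M 1%:M.
  by rewrite scale_block_mx !scaler0 scalar_mx_block add_block_mx !addr0 !add0r scale_scalar_mx mulr1.
have -> : block_mx 1%:M (- s^-1 *: Q) (- s^-1)%:M 1%:M =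
  block_mx 1%:M 0 (- s^-1)%:M 1%:M *m
  block_mx 1%:M (- s^-1 *: Q) 0 (1%:M - (s^-1 ^+ 2) *: Q).
  rewrite mulmx_block !mul1mx !mul0mx !mulmx1 ?mulmx0 ?addr0 ?add0r.
  by rewrite mul_scalar_mx scalerA mulrNN -expr2 addrCA subrr addr0.
rewrite det_mulmx det_lblock det_ublock !det1 !mul1r n'E exprM -detZ.
rewrite scalerBr scalerA -exprMn mulfV // expr1n scale1r scale_scalar_mx mulr1.
rewrite addrA -raddfD /=; congr (\det (_%:M - _)).
by rewrite /s; ring.
Qed.

End Bipartite.

(** Disjoint unions of cycles of length at least [4]. *)
Definition cycle_like (G : graph) : Prop :=
  [/\ simple_graph G, clique_le 2 G & forall x : vert G, #|[set y | adj x y]| = 2].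

Section CycleSubdivision.
Variable G : graph.
Hypothesis cycG : cycle_like G.

Lemma singleton_clique (x : vert G) : is_clique [set x] && ([set x] != finset.set0).
Proof.
rewrite -card_gt0 cards1 andbT; apply/is_cliqueP => y z.
by rewrite !inE => /eqP-> /eqP->; rewrite eqxx.
Qed.

Definition sing (x : vert G) : vert (bary G) := mk_simplex [set x] (singleton_clique x).

Lemma simplex_sing x : simplex (sing x) = [set x].
Proof. exact: mk_simplexK. Qed.

Lemma sing_inj : injective sing.
Proof. by move=> x y /(congr1 (@simplex G)); rewrite !simplex_sing => /finset.set1_inj. Qed.

Definition is_edge (s : vert (bary G)) : bool := #|simplex s| == 2.

Lemma bary_vertP (s : vert (bary G)) : is_edge s \/ exists x, s = sing x.
Proof.
have [_ le2 _] := cycG; have := le2 _ (bary_vert_clique s).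
have := bary_vert_neq0 s; rewrite -card_gt0 /is_edge.
case E: #|simplex s| => [|[|[|//]]] // _ _; [right|by left].
have /cards1P[x vx] : #|simplex s| == 1 by rewrite E.
by exists x; apply/simplex_inj; rewrite simplex_sing.
Qed.

Lemma is_edge_sing x : is_edge (sing x) = false.
Proof. by rewrite /is_edge simplex_sing cards1. Qed.

Lemma adj_sing x s : adj (sing x) s = is_edge s && (x \in simplex s).
Proof.
rewrite bary_adjE simplex_sing.
have [es|[y ->]] := bary_vertP s.
  rewrite es /= [X in _ || X](_ : _ = false) ?orbF; last first.
    apply/negP => /proper_card; rewrite cards1 (eqP es) //.
  by rewrite properEcard finset.sub1set cards1 (eqP es) andbT.
rewrite is_edge_sing /= simplex_sing.
by apply/negP => /orP[]/proper_card; rewrite !cards1.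
Qed.

Lemma adj_edges s t : is_edge s -> is_edge t -> adj s t = false.
Proof.
move=> /eqP es /eqP et; rewrite bary_adjE.
by apply/negP => /orP[]/proper_card; rewrite es et.
Qed.

Lemma card_edges_through x y :
  #|[set s | [&& is_edge s, x \in simplex s & y \in simplex s]]| = if x == y then 2 else adj x y.
Proof.
have [[symG irrG] le2 deg2] := cycG.
have edgeP (a b : vert G) : adj a b -> is_clique [set a; b] && ([set a; b] != finset.set0).
  move=> ab; have nab : a != b by apply: contraTneq ab => ->; rewrite irrG.
  rewrite -card_gt0 cards2 nab andbT; apply/is_cliqueP => u v.
  by rewrite !inE => /orP[]/eqP-> /orP[]/eqP->; rewrite ?eqxx // symG.
have edgeE (s : vert (bary G)) (a b : vert G) : is_edge s -> a \in simplex s -> b \in simplex s -> a != b ->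
    adj a b /\ simplex s = [set a; b].
  move=> /eqP es sa sb nab; split; first exact: (is_cliqueP (bary_vert_clique s)).
  apply/esym/eqP; rewrite eqEcard es cards2 nab andbT.
  by apply/subsetP => z; rewrite !inE => /orP[]/eqP->.
have [<-|nxy] := eqVneq x y; last first.
  have [axy|naxy] := boolP (adj x y).
    apply/eqP/cards1P; exists (mk_simplex [set x; y] (edgeP _ _ axy)); apply/setP => s.
    rewrite !inE; apply/and3P/eqP => [[es sx sy]|->].
      by apply/simplex_inj; rewrite mk_simplexK; have [] := edgeE s x y es sx sy nxy.
    by rewrite /is_edge mk_simplexK cards2 nxy !inE !eqxx orbT.
  apply/eqP; rewrite cards_eq0 -finset.subset0; apply/subsetP => s; rewrite !inE.
  by case/and3P=> es sx sy; have [axy _] := edgeE s x y es sx sy nxy; rewrite axy in naxy.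
rewrite -(deg2 x).
(* The other end of the edge [s]; the default is never reached when [s] is an edge through [x]. *)
pose other (s : vert (bary G)) : vert G := odflt x [pick z in simplex s | z != x].
have otherP (s : vert (bary G)) : is_edge s -> x \in simplex s ->
    [/\ other s \in simplex s, other s != x & simplex s = [set x; other s]].
  move=> es sx; rewrite /other; case: pickP => [z /andP[zs zx]|none] /=.
    by rewrite eq_sym in zx; have [_ E] := edgeE s x z es sx zs zx; split=> //; rewrite eq_sym.
  have : simplex s \subset [set x].
    by apply/subsetP => z zs; rewrite inE; have := none z; rewrite /= zs /= => /negbFE.
  by move=> /subset_leq_card; rewrite (eqP es) cards1.
rewrite -(@card_in_imset _ _ other).
  congr #|pred_of_set _|; apply/setP => z; rewrite inE; apply/imsetP/idP.
    case=> s; rewrite inE => /and3P[es sx _] ->; have [so ox _] := otherP s es sx.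
    by rewrite eq_sym in ox; have [] := edgeE s x _ es sx so ox.
  move=> xz; have nxz : x != z by apply: contraTneq xz => ->; rewrite irrG.
  pose s : vert (bary G) := mk_simplex [set x; z] (edgeP _ _ xz).
  have es : is_edge s by rewrite /is_edge mk_simplexK cards2 nxz.
  have sx : x \in simplex s by rewrite mk_simplexK !inE eqxx.
  exists s; first by rewrite inE es sx.
  have [so ox _] := otherP s es sx.
  by move: so; rewrite mk_simplexK !inE (negbTE ox) /= => /eqP.
move=> s t; rewrite !inE => /and3P[es sx _] /and3P[et tx _] ost; apply/simplex_inj.
by have [_ _ ->] := otherP s es sx; have [_ _ ->] := otherP t et tx; rewrite ost.
Qed.

(** Double counting: every vertex lies on two edges and every edge has two ends. *)
Lemma card_edge_vertices : #|[set s | is_edge s]| = #|vert G|.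
Proof.
apply/eqP; rewrite -(eqn_pmul2r (isT : 0 < 2)) -!sum_nat_const.
have -> : \sum_(x : vert G) 2 = \sum_(x : vert G) \sum_(s | is_edge s && (x \in simplex s)) 1.
  apply: eq_bigr => x _; rewrite sum1dep_card.
  have := card_edges_through x x; rewrite eqxx => <-; apply: eq_card => s; rewrite !inE.
  by rewrite andbb.
rewrite (exchange_big_dep is_edge) /=; last by move=> ? ? _ /andP[].
rewrite -big_set /= big_set; apply/eqP/eq_big => s; first by rewrite inE.
rewrite inE => es; rewrite -[LHS](eqP es) -sum1_card.
by apply: eq_bigl => x; rewrite es.
Qed.

Lemma card_bary_cycle : #|vert (bary G)| = 2 * #|vert G|.
Proof.
rewrite -(cardC [pred s | is_edge s]) mul2n -addnn; congr (_ + _).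
  by rewrite -card_edge_vertices; apply: eq_card => s; rewrite !inE.
rewrite -cardsT -(card_imset _ sing_inj); apply: eq_card => s; rewrite !inE.
apply/idP/imsetP => [ns|[x _ ->]]; last by rewrite is_edge_sing.
by have [es|[x ->]] := bary_vertP s; [rewrite es in ns|exists x; rewrite ?inE].
Qed.

Lemma cycle_like_bary : cycle_like (bary G).
Proof.
have [sG le2 deg2] := cycG; split; [exact: bary_simple|exact: clique_le_bary|].
move=> s; have [es|[x ->]] := bary_vertP s.
  rewrite -[RHS](eqP es) -(card_imset _ sing_inj); apply: eq_card => t.
  have [symB _] := bary_simple G.
  rewrite inE; apply/idP/imsetP => [st|[x xs ->]]; last by rewrite symB adj_sing es.
  have [et|[x tx]] := bary_vertP t; first by rewrite adj_edges in st.
  by exists x => //; move: st; rewrite tx symB adj_sing => /andP[].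
have := card_edges_through x x; rewrite eqxx => <-.
by apply: eq_card => s'; rewrite !inE adj_sing andbb.
Qed.

Section Determinant.
Local Open Scope ring_scope.
Variable R : realFieldType.

Let N := #|vert G|.
Let N' := #|vert (bary G)|.

(** The rows are indexed by all vertices of the refinement; those of singletons vanish, which makes
    the matrix orthogonal to the embedding of the old vertices. *)
Definition edge_incidence : 'M[R]_(N', N) :=
  \matrix_(i, j) (is_edge (vtx i) && (vtx j \in simplex (vtx i)))%:R.

Local Notation W := edge_incidence.
Local Notation P := (embed_mx R sing).

Lemma laplacian_baryE : full_laplacian R (bary G) = 2%:M - (P *m W^T + W *m P^T).
Proof.
have [[symB irrB] _ deg2] := cycle_like_bary.
have : forall i k, P i k = (vtx i == sing (vtx k))%:R by move=> i k; rewrite mxE.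
have : forall i k, W i k = (is_edge (vtx i) && (vtx k \in simplex (vtx i)))%:R.
  by move=> i k; rewrite mxE.
move: P W => p w wE pE.
have PW i j : (p *m w^T) i j = \sum_x (vtx i == sing x)%:R * (is_edge (vtx j) && (x \in simplex (vtx j)))%:R.
  rewrite mxE -(sum_vtx (fun x => (vtx i == sing x)%:R * (is_edge (vtx j) && (x \in simplex (vtx j)))%:R)).
  by apply: eq_bigr => k _; rewrite [_^T _ _]mxE pE wE.
have PWs i j x : vtx i = sing x -> (p *m w^T) i j = (adj (vtx i) (vtx j))%:R.
  move=> ix; rewrite PW ix adj_sing (bigD1 x) //= eqxx mul1r big1 ?addr0 // => y nyx.
  by rewrite (inj_eq sing_inj) eq_sym (negbTE nyx) mul0r.
have PWe i j : is_edge (vtx i) -> (p *m w^T) i j = 0.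
  move=> ei; rewrite PW big1 // => y _; case: eqP => [E|_]; last by rewrite mul0r.
  by rewrite E is_edge_sing in ei.
have -> : w *m p^T = (p *m w^T)^T by rewrite trmx_mul trmxK.
have PWsum i j : (p *m w^T) i j + (p *m w^T)^T i j = (adj (vtx i) (vtx j))%:R.
  rewrite [_^T _ _]mxE.
  have [ei|[x ix]] := bary_vertP (vtx i); have [ej|[y jy]] := bary_vertP (vtx j).
  - by rewrite (PWe i j ei) (PWe j i ej) (adj_edges ei ej) addr0.
  - by rewrite (PWe i j ei) (PWs j i y jy) add0r symB.
  - by rewrite (PWs i j x ix) (PWe j i ej) addr0.
  - by rewrite (PWs i j x ix) (PWs j i y jy) ix jy !adj_sing !is_edge_sing addr0.
apply/matrixP => i j; rewrite /full_laplacian laplacian_adjE; last exact: bary_simple.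
have := PWsum i j; move: (p *m w^T) => A; rewrite deg2 !mxE => ->.
have [->|_] := eqVneq i j; first by rewrite irrB subr0 mulr1n.
by rewrite mulr0n add0r.
Qed.

(** With [A] the adjacency matrix, the left side is [2 + A] and the Laplacian is [2 - A]. *)
Lemma edge_incidence_gram : W^T *m W = 4%:M - full_laplacian R G.
Proof.
have [sG le2 deg2] := cycG.
apply/matrixP => i j; rewrite mxE.
rewrite (eq_bigr (fun k => (fun s => (if [&& is_edge s, vtx i \in simplex s & vtx j \in simplex s]
   then 1 else 0 : R)) (vtx k))).
  rewrite (sum_vtx (fun s => (if [&& is_edge s, vtx i \in simplex s & vtx j \in simplex s]
   then 1 else 0 : R))) -big_mkcond /= -[LHS]/(\sum_(s | _) 1) sumr_const.
  rewrite (_ : #|_| = #|[set s | [&& is_edge s, vtx i \in simplex s & vtx j \in simplex s]]|).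
    rewrite card_edges_through mxE [X in _ = _ + X]mxE /full_laplacian laplacian_adjE //.
    rewrite mxE deg2 (inj_eq enum_val_inj).
    by case: eqVneq => _ /=; rewrite ?mulr1n ?mulr0n ?add0r ?opprK // -natrB.
  by apply: eq_card => s; rewrite !inE.
by move=> k _; rewrite !mxE; case: (is_edge _) => /=; rewrite ?mul0r //;
  case: (_ \in _); case: (_ \in _); rewrite ?mul1r ?mul0r.
Qed.

Lemma det_laplacian_bary t : 0 < t ->
  \det (t%:M + full_laplacian R (bary G)) =
  \det ((t ^+ 2 + 4 * t)%:M + full_laplacian R G).
Proof.
move=> t0; rewrite laplacian_baryE det_bipartite_laplacian //.
- by rewrite edge_incidence_gram opprB [4%:M + _]addrC addrNK.
- exact: card_bary_cycle.
- exact: embed_mxK sing_inj.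
- apply/matrixP => i j; rewrite mxE big1 ?mxE // => k _; rewrite !mxE.
  case: (vtx k =P sing (vtx j)) => [->|_]; last by rewrite mulr0.
  by rewrite is_edge_sing mul0r.
Qed.

End Determinant.
End CycleSubdivision.

(** * The golden ratio *)

Section CycleLimit.
Local Open Scope classical_set_scope.
Local Open Scope ring_scope.
Variable R : realType.

Lemma cycle_like_iter n (G : graph) : cycle_like G -> cycle_like (bary_iter n G).
Proof. by move=> cG; elim: n => //= n; apply: cycle_like_bary. Qed.

Lemma card_cycle_iter n (G : graph) : cycle_like G ->
  #|vert (bary_iter n G)| = (2 ^ n * #|vert G|)%N.
Proof.
move=> cG; elim: n => [|n IHn]; first by rewrite mul1n.
by rewrite /= card_bary_cycle ?IHn ?expnS ?mulnA //; apply: cycle_like_iter.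
Qed.

Definition subdivide (t : R) : R := t ^+ 2 + 4 * t.

Lemma iter_subdivide_ge n t : 0 < t -> t <= iter n subdivide t.
Proof.
move=> t0; elim: n => //= n IHn; apply: (le_trans IHn).
set u := iter _ _ _ in IHn *; have u0 := lt_le_trans t0 IHn.
by rewrite /subdivide -subr_ge0 (_ : _ - u = u ^+ 2 + 3 * u) ?addr_ge0 ?exprn_ge0 ?mulr_ge0 //;
  [exact: ltW|exact: ltW|ring].
Qed.

(** As long as the orbit stays below [1], one step multiplies by at most [5]. *)
Lemma iter_subdivide_le n t : 0 < t -> 5 ^+ n * t <= 1 -> iter n subdivide t <= 5 ^+ n * t.
Proof.
move=> t0; elim: n => [|n IHn] h; first by rewrite expr0 mul1r.
have t5 : 0 <= 5 ^+ n * t by rewrite mulr_ge0 ?exprn_ge0 // ltW.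
have h' : 5 ^+ n * t <= 1 by move: h; rewrite exprS -mulrA; lra.
have IH := IHn h'; have u0 := lt_le_trans t0 (iter_subdivide_ge n t0).
rewrite iterS exprS -mulrA; set u := iter _ _ _ in IH u0 *.
apply: (@le_trans _ _ (5 * u)); last by rewrite ler_wpM2l.
rewrite /subdivide (_ : 5 * u = u + 4 * u); last by ring.
by rewrite lerD2r expr2 ler_piMl ?(le_trans IH) // ltW.
Qed.

Lemma det_laplacian_bary_iter n (G : graph) t : cycle_like G -> 0 < t ->
  \det (t%:M + full_laplacian R (bary_iter n G)) =
  \det ((iter n subdivide t)%:M + full_laplacian R G).
Proof.
move=> cG; elim: n t => [|n IHn] t t0 //.
rewrite iterSr.
transitivity (\det ((subdivide t)%:M + full_laplacian R (bary_iter n G))).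
  exact: (det_laplacian_bary (cycle_like_iter n cG) t0).
by apply: IHn; rewrite /subdivide addr_gt0 ?exprn_gt0 ?mulr_gt0.
Qed.

Definition golden : R := (1 + Num.sqrt 5) / 2.

Lemma golden_sqr : golden ^+ 2 = golden + 1.
Proof.
have s5 : Num.sqrt 5 ^+ 2 = 5 :> R by rewrite sqr_sqrtr.
by rewrite /golden expr_div_n sqrrD s5 expr1n mul1r; field.
Qed.

Lemma golden_ge : 3 / 2 <= golden.
Proof.
have : 2 <= Num.sqrt 5 :> R.
  rewrite -[2]ger0_norm // -sqrtr_sqr ler_sqrt //; lra.
by rewrite /golden; lra.
Qed.

Lemma iter_subdivide_golden n (a := golden ^+ (2 ^ n.+1)) :
  a * (iter n subdivide 1 + 2) = a ^+ 2 + 1.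
Proof.
rewrite {}/a; elim: n => [|n IHn].
  rewrite /= expn1 golden_sqr; have := golden_sqr; set g := golden => gg.
  have -> : (g + 1) ^+ 2 = g ^+ 2 + 2 * g + 1 by ring.
  by rewrite gg; ring.
rewrite iterS expnS mulnC exprM; set a := golden ^+ _ in IHn *; set u := iter _ _ _ in IHn *.
rewrite (_ : a ^+ 2 * (subdivide u + 2) = (a * (u + 2)) ^+ 2 - 2 * a ^+ 2).
  by rewrite IHn; ring.
by rewrite /subdivide; ring.
Qed.

Lemma ln_iter_subdivide n :
  2 ^+ n.+1 * ln golden - ln 8 <= ln (iter n subdivide 1) <= 2 ^+ n.+1 * ln golden.
Proof.
have g0 : 0 < golden by apply: lt_le_trans golden_ge; lra.
have g1 : 1 <= golden by apply: le_trans golden_ge; lra.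
have := iter_subdivide_golden n; set a := golden ^+ _; set u := iter _ _ _ => au.
have u1 : 1 <= u by apply: iter_subdivide_ge.
have u0 : 0 < u := lt_le_trans ltr01 u1.
have lna : ln a = 2 ^+ n.+1 * ln golden by rewrite lnXn // -[LHS]mulr_natl natrX.
(* Here [a * u = (a - 1) ^ 2], which lies between [a ^ 2 / 8] and [a ^ 2] once [a] is at least
   [5 / 2]. *)
have a52 : 5 / 2 <= a.
  apply: (@le_trans _ _ (golden ^+ 2)).
    by rewrite golden_sqr; have := golden_ge; lra.
  by apply: ler_weXn2l => //; rewrite -[2%N]expn1 leq_exp2l.
have a0 : 0 < a by lra.
have h1 : u <= a.
  rewrite -(ler_pM2l a0) (_ : a * u = a ^+ 2 + 1 - 2 * a); last by rewrite -au; ring.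
  by rewrite -expr2; lra.
have h2 : a <= u * 8.
  rewrite -(ler_pM2l a0) (_ : a * (u * 8) = 8 * (a ^+ 2 + 1 - 2 * a)); last by rewrite -au; ring.
  have : 0 <= (a - 5 / 2) * (7 * a) by rewrite mulr_ge0 //; lra.
  rewrite mulrBl -expr2 (_ : a * (7 * a) = 7 * a ^+ 2); last by ring.
  by lra.
rewrite -lna; apply/andP; split; last by rewrite ler_ln ?posrE.
rewrite lerBlDr -lnM ?posrE // ler_ln ?posrE //.
by rewrite mulr_gt0.
Qed.

(** All edges are deleted: with no interior vertices every edge is bad, and what remains of the
    Laplacian is [0]. *)
Lemma ln_det_add (G : graph) t (m := #|bad_edges (pred0 : pred (vert G))|) : 0 < t ->
  [/\ 0 < \det (t%:M + full_laplacian R G),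
    #|vert G|%:R * ln t <= ln (\det (t%:M + full_laplacian R G)) &
    ln (\det (t%:M + full_laplacian R G)) <= #|vert G|%:R * ln t + m%:R * ln (1 + t^-1)].
Proof.
move=> t0; have tV0 : 0 <= t^-1 by rewrite invr_ge0 ltW.
have := @det_full_laplacian_inner R G pred0 _ tV0; rewrite /= -/m.
have -> : laplacian R (inner_edges (pred0 : pred (vert G))) = 0.
  by rewrite /laplacian big_pred0 ?scaler0 // => p; rewrite /inner_edges /= andbF.
rewrite scaler0 addr0 det1 mul1r => -[_ /andP[d1 d2]].
have d0 := lt_le_trans ltr01 d1.
have E : t%:M + full_laplacian R G = t *: (1%:M + t^-1 *: full_laplacian R G).
  by rewrite scalerDr scalerA mulfV ?gt_eqF // scale1r scale_scalar_mx mulr1.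
have dE : \det (t%:M + full_laplacian R G) =
    t ^+ #|vert G| * \det (1%:M + t^-1 *: full_laplacian R G) by rewrite E detZ.
have tn : 0 < t ^+ #|vert G| by rewrite exprn_gt0.
have t1 : 0 < 1 + t^-1 by rewrite ltr_pwDl.
rewrite dE lnM ?posrE // lnXn // !mulr_natl lerDl lerD2l; split.
- by rewrite mulr_gt0.
- by rewrite ln_ge0.
- by rewrite -lnXn // ler_ln ?posrE // exprn_gt0.
Qed.

(** Both determinants reduce to the fixed graph [G], at the orbits [u] of [1] and [w] of [eps]. With
    [eps = 16 ^- n] the fourth power of the [2 ^ n * N] vertices is compensated, and
    [5 ^ n * eps <= 1] keeps [w] between [eps] and [1]. So [u] yields the main term and [w] only an
    error linear in [n]. *)
Lemma log_ratio_cycle_iter (G : graph) : cycle_like G ->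
  exists2 c : R, 0 <= c & forall n,
    `|log_ratio R (bary_iter n G) - #|vert G|%:R * (2 ^+ n.+1 * ln golden)| <= c * n.+1%:R.
Proof.
move=> cG; have [sG _ _] := cG.
pose N : R := #|vert G|%:R; pose m : R := #|bad_edges (pred0 : pred (vert G))|%:R.
have N0 : 0 <= N by []. have m0 : 0 <= m by [].
pose l := ln 16 : R; pose l2 := ln 2 : R; pose l8 := ln 8 : R.
have l0 : 0 <= l by rewrite ln_ge0 // ler1n.
have l20 : 0 <= l2 by rewrite ln_ge0 // ler1n.
have l80 : 0 <= l8 by rewrite ln_ge0 // ler1n.
pose a := N ^+ 4 + N * l8 + 2 * (m * l2); pose b := 2 * (N * l) + m * l.
have a0 : 0 <= a by rewrite /a !addr_ge0 ?mulr_ge0 ?exprn_ge0.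
have b0 : 0 <= b by rewrite /b !addr_ge0 ?mulr_ge0.
exists (a + b); first exact: addr_ge0.
move=> n; pose eps : R := 16 ^- n.
have p16 : 0 < 16 ^+ n :> R by rewrite exprn_gt0.
have e0 : 0 < eps by rewrite invr_gt0.
have e1 : eps <= 1 by rewrite invf_le1 // exprn_ege1 // ler1n.
have lne : ln eps = - (n%:R * l) by rewrite lnV ?posrE // lnXn // mulr_natl.
have [S cS hS] := hitting_bary_iter n sG.
have := log_ratio_approx (bary_iter_simple n sG) hS e0 e1.
have [d1 _ _] := ln_det_add (bary_iter n G) e0.
rewrite reg_log_ratioE // !det_laplacian_bary_iter // card_cycle_iter //.
set u := iter n subdivide 1; set w := iter n subdivide eps.
have /andP[u_lo u_hi] := ln_iter_subdivide n; rewrite -/u -/l8 in u_lo u_hi.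
have u1 : 1 <= u by apply: iter_subdivide_ge.
have we : eps <= w by apply: iter_subdivide_ge.
have w1 : w <= 1.
  have h : 5 ^+ n * eps <= 1.
    by rewrite ler_pdivrMr // mul1r lerXn2r ?nnegrE // ler_nat.
  exact: le_trans (iter_subdivide_le e0 h) h.
have w0 : 0 < w := lt_le_trans e0 we.
have [_ U1 U2] := ln_det_add G (lt_le_trans ltr01 u1).
have [_ W1 W2] := ln_det_add G w0.
set DU := ln (\det (u%:M + _)) in U1 U2 *; set DW := ln (\det (w%:M + _)) in W1 W2 *.
rewrite -/N -/m in U1 U2 W1 W2.
set T := log_ratio R _; set g := 2 ^+ n.+1 * ln golden in u_lo u_hi *.
rewrite lne mulrN opprK => H.
have k0 : 0 <= n%:R * l by rewrite mulr_ge0.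
have H' : `|T - (DU - DW)| <= N ^+ 4 + N * (n%:R * l).
  apply: le_trans H _; apply: lerD.
    rewrite natrM natrX exprMn mulrC mulrA -/N -exprM mulnC exprM.
    rewrite (_ : (2 : R) ^+ 4 = 16); last by rewrite -natrX.
    by rewrite mulVf ?mul1r // gt_eqF.
  by rewrite ler_wpM2r // ler_nat.
have lw : ln w <= 0 by apply: ln_le0.
have lw' : - (n%:R * l) <= ln w by rewrite -lne ler_ln ?posrE.
have lwi : ln (1 + w^-1) <= l2 + n%:R * l.
  have wV0 : 0 < w^-1 by rewrite invr_gt0.
  have wV : w^-1 <= 16 ^+ n by rewrite -[16 ^+ n]invrK lef_pV2 ?posrE.
  have h16 : 1 <= 16 ^+ n :> R by rewrite exprn_ege1 // ler1n.
  rewrite /l /l2 mulr_natl -lnXn // -lnM ?posrE //.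
  move: (16 ^+ n) wV h16 => z wV h16.
  by rewrite ler_ln ?posrE; lra.
have lui : ln (1 + u^-1) <= l2.
  have uV0 : 0 < u^-1 by rewrite invr_gt0 (lt_le_trans ltr01).
  have uV1 : u^-1 <= 1 by rewrite invf_le1 // (lt_le_trans ltr01).
  by rewrite ler_ln ?posrE; lra.
have mw := ler_wpM2l m0 lwi; have mu := ler_wpM2l m0 lui.
have Nu1 := ler_wpM2l N0 u_lo; have Nu2 := ler_wpM2l N0 u_hi.
have Nw1 := ler_wpM2l N0 lw'; have Nw2 := ler_wpM2l N0 lw.
rewrite mulr0 in Nw2; rewrite mulrN in Nw1; rewrite mulrBr in Nu1; rewrite mulrDr in mw.
have DUg : `|DU - N * g| <= N * l8 + m * l2.
  have := mulr_ge0 N0 l80; have := mulr_ge0 m0 l20.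
  move: U1 U2 mu Nu1 Nu2.
  move: (N * ln u) (N * g) (N * l8) (m * l2) (m * ln (1 + u^-1)) => x1 x2 x3 x4 x5 *.
  by rewrite ler_norml; apply/andP; split; lra.
have DWb : `|DW| <= N * (n%:R * l) + (m * l2 + m * (n%:R * l)).
  have := mulr_ge0 N0 k0; have := mulr_ge0 m0 l20; have := mulr_ge0 m0 k0.
  move: W1 W2 mw Nw1 Nw2.
  move: (N * ln w) (N * (n%:R * l)) (m * l2) (m * (n%:R * l)) (m * ln (1 + w^-1)) => x1 x2 x3 x4 x5 *.
  by rewrite ler_norml; apply/andP; split; lra.
have -> : T - N * g = (T - (DU - DW)) + (DU - N * g) - DW by ring.
apply: le_trans (ler_normB _ _) _.
apply: le_trans (lerD (ler_normD _ _) (lexx _)) _.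
apply: le_trans (lerD (lerD H' DUg) DWb) _.
have -> : N ^+ 4 + N * (n%:R * l) + (N * l8 + m * l2) +
  (N * (n%:R * l) + (m * l2 + m * (n%:R * l))) = a + b * n%:R by rewrite /a /b; ring.
rewrite -natr1 (_ : (a + b) * (n%:R + 1) = a + b * n%:R + (a * n%:R + b)); last by ring.
by rewrite lerDl addr_ge0 // mulr_ge0.
Qed.

Lemma tree_forest_index_cycle (G : graph) : cycle_like G -> (0 < #|vert G|)%N ->
  (fun n => tree_forest_index R (bary_iter n G)) @ \oo --> 2 * ln golden.
Proof.
move=> cG G0; have [c c0 H] := log_ratio_cycle_iter cG.
have N0 : 0 < #|vert G|%:R :> R by rewrite ltr0n.
pose v n := (log_ratio R (bary_iter n G) - #|vert G|%:R * (2 ^+ n.+1 * ln golden)) / #|vert G|%:R.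
have Hv n : `|v n| <= c / #|vert G|%:R * n.+1%:R * 1 ^+ n.
  rewrite expr1n mulr1 normrM [`|_^-1|]ger0_norm ?invr_ge0 // mulrAC.
  by rewrite ler_wpM2r ?invr_ge0.
have v0 := cvg_linear_geometric ltr01 (ltr1n R 2) Hv.
rewrite (_ : (fun n => _) = (fun n => v n / 2 ^+ n + 2 * ln golden)).
  by rewrite -[X in _ --> X]add0r; apply: cvgD; [exact: v0|apply: cvg_cst].
apply/funext => n; rewrite /tree_forest_index -/(log_ratio R _) card_cycle_iter //.
rewrite natrM natrX /v exprS; field.
by rewrite expf_neq0 //= gt_eqF.
Qed.

End CycleLimit.

(** The 4-cycle; a triangle would be a clique and have dimension [2]. *)
Definition square : graph :=
  @Graph (bool * bool)%type (fun x y => (x.1 != y.1) (+) (x.2 != y.2)).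

Lemma square_cycle_like : cycle_like square.
Proof.
split; first by split=> [[[] []] [[] []]|[[] []]].
  move=> A /is_cliqueP cA.
  (* The graph is bipartite by parity, so a clique has at most one vertex of each parity. *)
  pose f (x : vert square) := x.1 (+) x.2.
  have injf : {in A &, injective f}.
    move=> x y xA yA fxy; apply/eqP/negPn/negP => nxy.
    have := cA x y xA yA nxy; move: fxy nxy.
    by case: x {xA} => [[] []]; case: y {yA} => [[] []].
  rewrite -(card_in_imset injf) -card_bool; exact: max_card.
move=> x; rewrite (_ : finset _ = [set (~~ x.1, x.2); (x.1, ~~ x.2)]).
  by rewrite cards2; case: x => [[] []].
by apply/setP => y; rewrite !inE; case: x => [[] []]; case: y => [[] []].
Qed.

Lemma gdim_square : gdim square = 1.
Proof.
have v0 : 0 < #|vert square| by rewrite card_prod card_bool.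
have [symS irrS] : simple_graph square by have [] := square_cycle_like.
have [le gt] := max_clique_sizeP v0.
have [_ le2 _] := square_cycle_like.
apply/eqP; rewrite -eqSS eqn_leq; apply/andP; split.
  move: gt => /card_gt0P[A]; rewrite inE => /andP[cA /eqP <-]; exact: le2.
pose e : {set vert square} := [set (true, true); (true, false)].
have ce : is_clique e.
  apply/is_cliqueP => u v; rewrite !inE.
  by move=> /orP[]/eqP-> /orP[]/eqP->.
by have := le e ce; rewrite cards2.
Qed.

Local Open Scope classical_set_scope.
Local Open Scope ring_scope.

Theorem mainTheorem1 (R : realType) :
  exists L : nat -> R,
    (forall G : graph, simple_graph G -> (0 < #|vert G|)%N ->
       (fun n => tree_forest_index R (bary_iter n G)) @ \oo --> L (gdim G))
    /\ L 1%N = 2 * ln ((1 + Num.sqrt 5) / 2).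
Proof.
have [L HL] := boolp.choice (@tree_forest_index_limit R).
exists L; split=> [G sG G0|]; first exact: HL.
have v0 : (0 < #|vert square|)%N by rewrite card_prod card_bool.
have [sS _ _] := square_cycle_like.
have H1 := HL 1%N square sS v0 gdim_square.
have H2 := @tree_forest_index_cycle R _ square_cycle_like v0.
by rewrite -(cvg_lim _ H1) // (cvg_lim _ H2).
Qed.
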